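(* Let $d\ge 2$, let $\beta_0>0$ be fixed and let $\beta>\beta_0$. Then $$Z(t,\beta)\ge\exp\left(-\gamma\, t^{1-2/(d+1)}\beta^{2/(d+1)}\right),$$ where $\gamma$ is a constant depending only on $\beta_0$ and $d$.
   Context: Let $(X_s)_{s\ge 0}$ be the continuous-time simple random walk on $\mathbb{Z}^d$ started from $0$ in which each edge has rate one (so the walk jumps from its current site to each of its $2d$ neighbours at rate $1$), with expectation $\mathbb{E}$. Let $R_t=\{v\in\mathbb{Z}^d: X_s=v\text{ for some } s\le t\}$ be the range at time $t$. For $G\subset\mathbb{Z}^d$, $\partial G=\{x\in G: x\sim y\text{ for some } y\notin G\}$ is the inner vertex boundary ($x\sim y$ means nearest neighbours). The partition function is $Z(t,\beta)=\mathbb{E}[\exp(-\beta|\partial R_t|)]$.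
   Formalization: The bound is proved for all t ≥ β; without a lower bound on t the claim is false, since at t = 0 one has Z = exp(−β) < 1 while the right-hand side equals 1, and in general some t ≥ cβ is necessary. *)

(* Defs.v *)
From HB Require Import structures.
From mathcomp Require Import all_boot all_order all_algebra finmap.
From mathcomp Require Import all_classical all_reals all_analysis.
Set Implicit Arguments.
Unset Strict Implicit.
Unset Printing Implicit Defensive.
Import Order.TTheory GRing.Theory Num.Theory.
Import numFieldNormedType.Exports.
Local Open Scope classical_set_scope.
Local Open Scope ring_scope.

Definition adjacent (d : nat) (x y : 'rV[int]_d) : bool :=
  \sum_(i < d) `|x 0 i - y 0 i| == 1.

Definition inner_boundary (d : nat) (G : set 'rV[int]_d) : set 'rV[int]_d :=
  [set x | G x /\ exists y, adjacent x y /\ ~ G y].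

Definition mutually_independent (disp : measure_display)
    (T : measurableType disp) (R : realType) (P : probability T R)
    (I : choiceType) (F : I -> set (set T)) : Prop :=
  forall (J : {fset I}) (E : I -> set T), (forall i, i \in J -> F i (E i)) ->
    (P (\bigcap_(i in [set` J]) E i) = \prod_(i <- J) P (E i))%E.

(* The events determined by the holding times (left indices) and by the steps
   (right indices); Z^d carries its discrete sigma-algebra. *)
Definition walk_events (disp : measure_display) (T : measurableType disp)
    (R : realType) (d : nat) (hold : nat -> T -> R)
    (step : nat -> T -> 'rV[int]_d) (i : nat + nat) : set (set T) :=
  match i with
  | inl n => preimage_set_system setT (hold n) measurable
  | inr n => preimage_set_system setT (step n) setT
  end.

Definition jump_time (T : Type) (R : realType) (hold : nat -> T -> R)
    (n : nat) (w : T) : R := \sum_(0 <= k < n) hold k w.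

Definition jump_chain (T : Type) (d : nat) (step : nat -> T -> 'rV[int]_d)
    (n : nat) (w : T) : 'rV[int]_d := \sum_(0 <= k < n) step k w.

(* Leaving along each of the 2d incident edges at rate 1 means: wait an
   exponential time of rate 2d, then move to a uniformly chosen neighbour.
   As usual for a jump process, every sample path (and not merely almost every
   one) is required to be a right-continuous step function with finitely many
   jumps in bounded time; this makes |boundary of the range| measurable.
   [X s] is meaningful for [0 <= s] only. *)
Record walk_construction (disp : measure_display) (T : measurableType disp)
    (R : realType) (P : probability T R) (d : nat) (X : R -> T -> 'rV[int]_d)
    (hold : nat -> {RV P >-> R}) (step : nat -> T -> 'rV[int]_d) : Prop := {
  hold_law : forall n (A : set R), measurable A ->
    distribution P (hold n) A = exponential_prob (2 * d)%:R A;
  step_measurable : forall n (A : set 'rV[int]_d), measurable (step n @^-1` A);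
  step_law : forall n (e : 'rV[int]_d), adjacent 0 e ->
    P (step n @^-1` [set e]) = ((2 * d)%:R^-1)%:E;
  hold_step_independent : mutually_independent P (walk_events hold step);
  hold_gt0 : forall n w, 0 < hold n w;
  jump_time_cvg : forall w, jump_time hold n w @[n --> \oo] --> +oo;
  walk_path : forall n w s, jump_time hold n w <= s < jump_time hold n.+1 w ->
    X s w = jump_chain step n w
}.

Definition simple_random_walk (disp : measure_display)
    (T : measurableType disp) (R : realType) (P : probability T R) (d : nat)
    (X : R -> T -> 'rV[int]_d) : Prop :=
  exists (hold : nat -> {RV P >-> R}) (step : nat -> T -> 'rV[int]_d),
    walk_construction X hold step.

Definition walk_range (T : Type) (R : realType) (d : nat)
    (X : R -> T -> 'rV[int]_d) (t : R) (w : T) : set 'rV[int]_d :=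
  [set v | exists s, 0 <= s <= t /\ X s w = v].

(* [fset_set] is the finite set underlying a finite [set]; the range of a walk
   up to a finite time is finite, so this is the true cardinality. *)
Definition boundary_size (T : Type) (R : realType) (d : nat)
    (X : R -> T -> 'rV[int]_d) (t : R) (w : T) : nat :=
  #|` fset_set (inner_boundary (walk_range X t w))|.

Definition partition_function (disp : measure_display)
    (T : measurableType disp) (R : realType) (P : probability T R) (d : nat)
    (X : R -> T -> 'rV[int]_d) (t beta : R) : \bar R :=
  ('E_P[fun w => expR (- (beta * (boundary_size X t w)%:R))])%E.

(* Main.v *)
(** Let [A = 2 ^ J] and [N = A ^ 4], where [J] is largest with
    [beta * A ^ (4 * (d + 1)) <= t]; the target exponent is at least
    [beta * A ^ (4 * (d - 1))]. The walk is made to visit all points of the cube of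
    radius [N] except a crust of bounded thickness, and not to leave the cube before
    time [t], so that the boundary of its range lies in the crust, which has
    [O(A ^ (4 * (d - 1)))] points. Staying in the cube costs [O(t / N ^ 2)].

    A walk that is merely confined to the cube leaves too many holes near the faces.
    Instead it follows a tour of the faces and, at suitable points, inserts loops: each
    Whitney cell of scale [L = a ^ 4] is covered by a loop of [2 * a ^ (4 * d + 3)]
    steps inside a box of side [O(L)] touching a face. Such a loop costs only
    [O(a ^ (4 * d - 5)) = O(L ^ (d - 1) / a)], so the sum over the scales [a = 2 ^ l] is
    a geometric series, dominated by the number of points of the crust.

    Loops are counted spectrally. The number of closed walks of [n] steps in a box is
    at least [Lam ^ n], up to a polynomial factor, while those avoiding a point [v] of
    the core number at most [(Lam - delta) ^ n], with [delta] of order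
    [a ^ - (4 * d + 2)]. This gap is a Poincare inequality for functions [h * g] with
    [g v = 0], where [h] is the product-of-sines eigenfunction. Paths of straight
    segments ending at [v] would give only [delta] of order [L ^ - (d + 1)]; the
    improvement by [a ^ 2] comes from routing the paths through one of [a ^ 2] parallel
    hyperplanes near [v], chosen so that it carries little energy. *)
Require Import Defs.
From HB Require Import structures.
From mathcomp Require Import all_boot all_order all_algebra finmap.
From mathcomp Require Import all_classical all_reals all_analysis.
From mathcomp Require Import ring lra zify.
From mathcomp Require Import measurable_realfun.
Import Order.TTheory GRing.Theory Num.Theory.
Import numFieldNormedType.Exports.
Set Implicit Arguments.
Unset Strict Implicit.
Unset Printing Implicit Defensive.
Local Open Scope classical_set_scope.
Local Open Scope ring_scope.

(** * Walks on a finite graph *)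

Section Walks.
Variables (T : finType) (a : rel T).

Fixpoint walks (n : nat) (x : T) : seq (seq T) :=
  if n is m.+1 then [seq z :: p | z <- enum (a x), p <- walks m z]
  else [:: [::]].

Lemma mem_walks n x p : (p \in walks n x) = (size p == n) && path a x p.
Proof.
elim: n x p => [|n IH] x [|z p] //=.
  by apply/negbTE/allpairsPdep => -[y [q [_ _]]].
apply/allpairsPdep/idP => [[y [q [ay qw [-> ->]]]]|].
  by move: qw; rewrite IH eqSS mem_enum in ay * => /andP[-> ->]; rewrite andbT.
move=> /and3P[sp axz pp]; exists z, p; split=> //; first by rewrite mem_enum.
by rewrite IH -eqSS sp.
Qed.

Lemma uniq_walks n x : uniq (walks n x).
Proof.
elim: n x => [|n IH] x //=.
apply: allpairs_uniq_dep => [|y _|]; rewrite ?enum_uniq //.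
by move=> [y p] [z q] _ _ /= [-> ->].
Qed.

Lemma count_walksS P n x :
  count P (walks n.+1 x) = (\sum_(z | a x z) count (P \o cons z) (walks n z))%N.
Proof.
rewrite /= count_flatten -map_comp sumnE big_map big_enum /=.
by apply: eq_bigr => z _; rewrite /= count_map.
Qed.

Variable R : realType.

Definition nbr_sum (Q : pred T) (f : T -> R) (x : T) : R :=
  \sum_(z | a x z && Q z) f z.

(** Powers of the adjacency operator count walks. The start [x] is exempt from [Q]: only the sites
    of [p] are tested. *)
Lemma count_walks_iter (Q : pred T) n x y :
  (count (fun p => (last x p == y) && all Q p) (walks n x))%:R =
  iter n (nbr_sum Q) (fun z => (z == y)%:R) x :> R.
Proof.
elim: n x => [|n IH] x; first by rewrite /= andbT addn0.
rewrite count_walksS natr_sum iterS /nbr_sum big_mkcondr.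
apply: eq_bigr => z _; case: ifP => Qz; last first.
  by rewrite (eq_count (a2 := pred0)) ?count_pred0 // => p /=; rewrite Qz andbF.
by rewrite -IH; congr _%:R; apply: eq_count => p /=; rewrite Qz.
Qed.

Lemma size_walks_iter n x :
  (size (walks n x))%:R = iter n (nbr_sum predT) (fun=> 1) x :> R.
Proof.
elim: n x => [|n IH] x //; rewrite -count_predT count_walksS natr_sum iterS.
rewrite /nbr_sum; under eq_bigl do rewrite -[a x _]andbT.
by apply: eq_bigr => z _; rewrite -IH -count_predT.
Qed.

(** Since [h <= 1], the iterates of the constant function dominate those of [h], which are
    [lam ^+ n * h]. *)
Lemma free_walks_ge (h : T -> R) (lam : R) n x :
    (forall y, h y <= 1) -> 0 <= lam ->
    (forall y, nbr_sum predT h y = lam * h y) ->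
  lam ^+ n * h x <= (size (walks n x))%:R.
Proof.
move=> h1 lam0 hE; rewrite size_walks_iter.
elim: n x => [|n IH] x; first by rewrite expr0 mul1r.
rewrite exprSr -mulrA -hE iterS mulr_sumr; exact: ler_sum.
Qed.

Hypothesis a_sym : symmetric a.

Definition dot (f g : T -> R) : R := \sum_x f x * g x.

Lemma dotC f g : dot f g = dot g f.
Proof. by apply: eq_bigr => x _; rewrite mulrC. Qed.

Lemma dot_ge0 f : 0 <= dot f f.
Proof. by apply: sumr_ge0 => x _; rewrite -expr2 sqr_ge0. Qed.

Lemma dotDl f g k : dot (fun x => f x + g x) k = dot f k + dot g k.
Proof. by rewrite -big_split; apply: eq_bigr => x _; rewrite mulrDl. Qed.

Lemma dotZl c f k : dot (fun x => c * f x) k = c * dot f k.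
Proof. by rewrite mulr_sumr; apply: eq_bigr => x _; rewrite mulrA. Qed.

Lemma dotDr f g k : dot k (fun x => f x + g x) = dot k f + dot k g.
Proof. by rewrite dotC dotDl !(dotC k). Qed.

Lemma dotZr c f k : dot k (fun x => c * f x) = c * dot k f.
Proof. by rewrite dotC dotZl (dotC k). Qed.

Lemma dot_CS f g : dot f g ^+ 2 <= dot f f * dot g g.
Proof.
have [g0|g0] := eqVneq (dot g g) 0.
  have gx0 x : g x = 0.
    move/eqP: g0; rewrite psumr_eq0; last by move=> y _; rewrite -expr2 sqr_ge0.
    by move=> /allP /(_ x (mem_index_enum x)) /=; rewrite mulf_eq0 orbb => /eqP.
  by rewrite g0 mulr0 [dot f g]big1 ?expr0n // => x _; rewrite gx0 mulr0.
have gp : 0 < dot g g by rewrite lt_def g0 dot_ge0.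
have := dot_ge0 (fun x => dot g g * f x + (- dot f g) * g x).
rewrite dotDl !dotDr !dotZl !dotZr (dotC g f) => H.
rewrite -subr_ge0 -(pmulr_rge0 _ gp); apply: le_trans H _.
by rewrite le_eqVlt; apply/orP; left; apply/eqP; ring.
Qed.

Definition form (f g : T -> R) : R := dot f (nbr_sum predT g).

Lemma formE f g : form f g = \sum_x \sum_(y | a x y) f x * g y.
Proof.
apply: eq_bigr => x _; rewrite /nbr_sum mulr_sumr.
by apply: eq_bigl => y; rewrite andbT.
Qed.

Lemma form_sym f g : form f g = form g f.
Proof.
rewrite !formE; under eq_bigr do rewrite big_mkcond.
rewrite exchange_big; apply: eq_bigr => y _; rewrite [RHS]big_mkcond.
by apply: eq_bigr => x _; rewrite a_sym mulrC.
Qed.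

Lemma formDl f g k : form (fun x => f x + g x) k = form f k + form g k.
Proof. exact: dotDl. Qed.

Lemma formDr f g k : form k (fun x => f x + g x) = form k f + form k g.
Proof. by rewrite form_sym formDl !(form_sym k). Qed.

Lemma formNl f k : form (fun x => - f x) k = - form f k.
Proof.
by rewrite /form /dot -sumrN; apply: eq_bigr => x _; rewrite mulNr.
Qed.

Lemma formNr f k : form k (fun x => - f x) = - form k f.
Proof. by rewrite form_sym formNl (form_sym k). Qed.

(** Variational form of: the adjacency matrix with row and column [v] deleted has largest eigenvalue
    at most [mu]. *)
Definition form_le_off (v : T) (mu : R) :=
  forall f, f v = 0 -> form f f <= mu * dot f f.

(** The matrix entries are nonnegative, so passing to [|f|] turns the upper bound on the form into a
    bound on its absolute value. *)
Lemma form_abs v mu f : form_le_off v mu -> f v = 0 ->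
  `|form f f| <= mu * dot f f.
Proof.
move=> H fv; have -> : dot f f = dot (fun x => `|f x|) (fun x => `|f x|).
  by apply: eq_bigr => x _; rewrite -normrM ger0_norm // -expr2 sqr_ge0.
apply: le_trans (H (fun x => `|f x|) _); last by rewrite fv normr0.
rewrite !formE; apply: le_trans (ler_norm_sum _ _ _) _; apply: ler_sum => x _.
apply: le_trans (ler_norm_sum _ _ _) _; apply: ler_sum => y _.
by rewrite normrM.
Qed.

Definition off (v : T) (f : T -> R) (x : T) : R := if x == v then 0 else f x.

(** Polarization, [4 form f g = form (f + g) (f + g) - form (f - g) (f - g)], and the parallelogram
    law. *)
Lemma form_polar v mu f g : form_le_off v mu -> f v = 0 -> g v = 0 ->
  form f g <= mu / 2 * (dot f f + dot g g).
Proof.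
move=> H fv gv.
have := form_abs (f := fun x => f x + g x) H.
rewrite fv gv addr0 => /(_ erefl); rewrite ler_norml => /andP[_ H1].
have := form_abs (f := fun x => f x + - g x) H.
rewrite fv gv subr0 => /(_ erefl); rewrite ler_norml => /andP[H2 _].
move: H1 H2; rewrite !(formDl, formDr, formNl, formNr) (form_sym g f).
have NE k : (fun x => - k x) = (fun x => -1 * k x) :> (T -> R).
  by apply: funext => x; rewrite mulN1r.
rewrite !(dotDl, dotDr) NE !(dotZl, dotZr) (dotC g f) => H1 H2.
nra.
Qed.

(* Polarization against the image of [f] turns the bound on the quadratic form into a
   bound on the operator norm. *)
Lemma norm_off_nbr_sum v mu f : 0 < mu -> form_le_off v mu -> f v = 0 ->
  dot (off v (nbr_sum predT f)) (off v (nbr_sum predT f)) <= mu ^+ 2 * dot f f.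
Proof.
move=> mu0 H fv; set g := off v _.
have gv : g v = 0 by rewrite /g /off eqxx.
have gE : form g f = dot g g.
  apply: eq_bigr => x _; rewrite {3}/g /off; case: eqP => [->|//].
  by rewrite gv !mul0r.
have := @form_polar v mu (fun x => mu^-1 * g x) f H.
rewrite gv mulr0 => /(_ erefl fv).
rewrite {1}/form !(dotZl, dotZr) -/(form g f) gE => H1.
have {H1} : mu * (mu^-1 * dot g g) <=
    mu * (mu / 2 * (mu^-1 * (mu^-1 * dot g g) + dot f f)).
  by rewrite ler_pM2l.
have -> : mu * (mu / 2 * (mu^-1 * (mu^-1 * dot g g) + dot f f)) =
  dot g g / 2 + mu ^+ 2 * dot f f / 2 by field; rewrite gt_eqF.
rewrite mulrA divff ?gt_eqF // mul1r; lra.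
Qed.

(** The count is the value at [x] of the [n]-th power of the operator projected off [v], applied to
    the indicator of [y], a unit vector; one value is at most the norm. *)
Lemma avoiding_walks_le v mu n x y : 0 < mu -> form_le_off v mu ->
    y != v -> x != v ->
  (count (fun p => (last x p == y) && all (predC1 v) p) (walks n x))%:R
    <= mu ^+ n.
Proof.
move=> mu0 H yv xv; rewrite count_walks_iter.
(* Cutting the iterates off at [v] allows the full neighbour sum in the recursion [FS]. *)
pose F n := off v (iter n (nbr_sum (predC1 v)) (fun z => (z == y)%:R)).
have FS m : F m.+1 = off v (nbr_sum predT (F m)).
  apply: funext => z; rewrite /F /off; case: eqP => // _.
  rewrite iterS /nbr_sum big_mkcondr [RHS]big_mkcondr; apply: eq_bigr => w _ /=.
  by case: eqP.
have F2 m : dot (F m) (F m) <= (mu ^+ m) ^+ 2.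
  elim: m => [|m IH].
    rewrite expr0 expr1n /dot /F /off /= (bigD1 y) //= (negbTE yv) eqxx mulr1.
    by rewrite big1 ?addr0 // => z /negbTE ->; case: eqP; rewrite mulr0.
  rewrite FS; apply: le_trans (norm_off_nbr_sum mu0 H _) _; rewrite /F.
    by rewrite /off eqxx.
  by rewrite [mu ^+ m.+1]exprS exprMn ler_pM2l // exprn_gt0.
have -> : iter n (nbr_sum (predC1 v)) (fun z => (z == y)%:R) x = F n x.
  by rewrite /F /off (negbTE xv).
apply: le_trans (ler_norm _) _.
rewrite -(@ler_pXn2r _ 2) ?nnegrE ?normr_ge0 //; last first.
  by rewrite exprn_ge0 // ltW.
apply: le_trans (F2 n); rewrite real_normK ?num_real // /dot (bigD1 x) //=.
rewrite -expr2 lerDl; apply: sumr_ge0 => z _; rewrite -expr2; exact: sqr_ge0.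
Qed.

(** Cauchy-Schwarz for [h] and the [m]-th iterate of the indicator of [x]: their product is
    [lam ^+ m * h x] by symmetry, and the squared norm of the iterate counts closed walks of [m + m]
    steps. *)
Lemma closed_walks_ge (h : T -> R) (lam : R) m x :
    (forall y, nbr_sum predT h y = lam * h y) ->
  (lam ^+ m * h x) ^+ 2 <=
  (count (fun p => last x p == x) (walks (m + m) x))%:R * dot h h.
Proof.
move=> hE; pose e z : R := (z == x)%:R.
have symI k f g : dot (iter k (nbr_sum predT) f) g = dot f (iter k (nbr_sum predT) g).
  elim: k f => [//|k IH] f; rewrite iterSr IH iterS.
  by rewrite dotC -/(form _ _) form_sym.
have iterh k : iter k (nbr_sum predT) h = fun y => lam ^+ k * h y.
  elim: k => [|k IH]; first by apply: funext => y; rewrite expr0 mul1r.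
  rewrite iterS IH; apply: funext => y; rewrite exprSr -mulrA -hE mulr_sumr.
  by [].
have dote f : dot e f = f x.
  rewrite /dot (bigD1 x) //= /e eqxx mul1r big1 ?addr0 // => z /negbTE ->.
  by rewrite mul0r.
have -> : lam ^+ m * h x = dot (iter m (nbr_sum predT) e) h.
  by rewrite symI dote iterh.
have -> : (count (fun p => last x p == x) (walks (m + m) x))%:R =
    dot (iter m (nbr_sum predT) e) (iter m (nbr_sum predT) e).
  rewrite symI dote -iterD -count_walks_iter; congr _%:R; apply: eq_count => p /=.
  by rewrite all_predT andbT.
exact: dot_CS.
Qed.

(** Union bound: from the closed walks one removes, for each [v] in [U], those that avoid [v]. *)
Lemma covering_walks_ge (U : seq T) (h : T -> R) (lam mu : R) m x :
    0 < mu -> (forall y, nbr_sum predT h y = lam * h y) -> 0 < dot h h ->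
    (forall v, v \in U -> form_le_off v mu) -> (0 < m)%N ->
  (lam ^+ m * h x) ^+ 2 / dot h h - (size U)%:R * mu ^+ (m + m) <=
  (count (fun p => (last x p == x) && all (fun v => v \in x :: p) U)
         (walks (m + m) x))%:R.
Proof.
move=> mu0 hE hh0 HU m0.
apply: (@le_trans _ _ ((count (fun p => last x p == x) (walks (m + m) x))%:R
                       - (size U)%:R * mu ^+ (m + m))).
  by rewrite lerD2r ler_pdivrMr // closed_walks_ge.
rewrite lerBlDr; elim: U HU => [|v U IH] HU.
  by rewrite mul0r addr0 ler_nat; apply: sub_count => p ->.
have /IH {}IH : forall v, v \in U -> form_le_off v mu.
  by move=> w wU; apply: HU; rewrite inE wU orbT.
apply: le_trans IH _; rewrite /= mulrS mulrDl mul1r addrA lerD2r.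
set W := walks _ _; set Q := fun p => _ && all _ U.
pose av p := (last x p == x) && (v \notin x :: p).
have avle : (count av W)%:R <= mu ^+ (m + m).
  have [xv|xv] := eqVneq x v.
    rewrite (eq_count (a2 := pred0)) ?count_pred0 ?exprn_ge0 ?ltW // => p.
    by rewrite /av /= xv inE eqxx andbF.
  apply: le_trans (avoiding_walks_le (m + m) mu0 (HU v (mem_head _ _)) xv xv).
  rewrite ler_nat; apply: sub_count => p /andP[-> /=].
  rewrite inE negb_or => /andP[_ vp]; apply/allP => z zp /=.
  by apply: contraNneq vp => <-.
apply: le_trans (lerD (lexx _) avle).
rewrite -natrD ler_nat -count_predUI.
apply: leq_trans (leq_addr _ _); apply: sub_count => p; rewrite /Q /= => /andP[lp ap].
by rewrite /av lp ap /= andbT; exact: orbN.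
Qed.

End Walks.

(** * The sine eigenfunction *)

Section Sine.
Variable R : realType.

(** The chord inequality with denominators cleared: increments decrease, so those after [j] are at
    most [D j] and those before [j] at least [D j]. *)
Lemma concave_seq (u : nat -> R) (m i j l : nat) :
    (forall k, (k.+2 <= m)%N -> u k + u k.+2 <= 2 * u k.+1) ->
    (i <= j <= l)%N -> (l <= m)%N ->
  (l - j)%:R * u i + (j - i)%:R * u l <= (l - i)%:R * u j.
Proof.
move=> cv /andP[ij jl] lm; have [jl1|jl1] := ltnP j l; last first.
  have -> : l = j by apply/eqP; rewrite eqn_leq jl1 jl.
  by rewrite subnn mul0r add0r.
pose D k := u k.+1 - u k.
have DS k : (k.+2 <= m)%N -> D k.+1 <= D k by move=> /cv; rewrite /D; lra.
have up p : (j + p <= m)%N -> (0 < p)%N || (j < m)%N ->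
    u (j + p)%N - u j <= p%:R * D j /\ ((j + p < m)%N -> D (j + p)%N <= D j).
  elim: p => [|p IH] jp _.
    by rewrite addn0 subrr mul0r; split.
  have [||IH1 IH2] := IH; [by rewrite ltnW // -addnS|by rewrite orbC; lia|].
  have Dp : D (j + p)%N <= D j by apply: IH2; rewrite -addnS.
  rewrite !addnS; split=> [|H].
    by move: Dp IH1; rewrite /D -natr1; lra.
  by apply: le_trans Dp; apply: DS.
have dn p : (p <= j)%N -> p%:R * D j <= u j - u (j - p)%N /\ D j <= D (j - p)%N.
  elim: p => [|p IH] pj; first by rewrite subn0 subrr mul0r.
  have [|IH1 IH2] := IH; first exact: ltnW.
  have E : (j - p = (j - p.+1).+1)%N by rewrite -subSn // subSS.
  have Dp : D j <= D (j - p.+1)%N by apply: le_trans IH2 _; rewrite E; apply: DS; lia.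
  split=> //; move: Dp IH1; rewrite E -natr1 /D; lra.
have [||U _] := up (l - j)%N; [by rewrite subnKC|by lia|].
have [|V _] := dn (j - i)%N; first by lia.
rewrite subnKC // in U; rewrite subKn // in V.
have -> : (l - i)%:R = (l - j)%:R + (j - i)%:R :> R by rewrite -natrD; congr _%:R; lia.
have P : 0 <= (l - j)%:R :> R by []. have Q : 0 <= (j - i)%:R :> R by [].
have := ler_wpM2l P V; have := ler_wpM2l Q U; lra.
Qed.

Lemma sin_le (x : R) : 0 <= x -> sin x <= x.
Proof.
move=> x0; have [|c _] := @MVT_segment R sin cos 0 x x0.
  exact/continuous_subspaceT/continuous_sin.
rewrite sin0 !subr0 => ->; rewrite ler_piMl //; exact: cos_le1.
Qed.

Lemma cos_ge (x : R) : 0 <= x <= pi -> 1 - x ^+ 2 / 2 <= cos x.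
Proof.
move=> /andP[x0 xpi]; have E : x = (x / 2) *+ 2 by rewrite mulr2n; lra.
have s0 : 0 <= sin (x / 2) by rewrite sin_ge0_pi //; lra.
have s1 : sin (x / 2) <= x / 2 by rewrite sin_le //; lra.
rewrite {2}E cos_mulr2n cos2sin2; nra.
Qed.

Section SineSeq.
Variable n : nat.

(** [sinseq] is the Dirichlet ground state of the path on [0, ..., n]; its zeros sit at the virtual
    indices [-1] and [n + 1]. *)
Definition theta : R := pi / n.+2%:R.
Definition sinseq (k : nat) : R := sin (theta * k.+1%:R).

Lemma theta_gt0 : 0 < theta.
Proof. by rewrite divr_gt0 ?pi_gt0. Qed.

Lemma theta_le : theta <= pi / 2.
Proof. by rewrite ler_pM2l ?pi_gt0 // lef_pV2 ?posrE // ler_nat. Qed.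

Lemma cos_theta_ge0 : 0 <= cos theta.
Proof.
by apply: cos_ge0_pihalf; rewrite theta_le andbT; have := theta_gt0; have := @pi_gt0 R; lra.
Qed.

Lemma sinseq_end : sinseq n.+1 = 0.
Proof. by rewrite /sinseq /theta divfK ?sinpi. Qed.

Lemma sinseq_gt0 k : (k <= n)%N -> 0 < sinseq k.
Proof.
move=> kn; apply: sin_gt0_pi; rewrite mulr_gt0 ?theta_gt0 //= /theta.
by rewrite -mulrA gtr_pMr ?pi_gt0 // mulrC ltr_pdivrMr // mul1r ltr_nat !ltnS.
Qed.

Lemma sinseq_le1 k : sinseq k <= 1.
Proof. exact: sin_le1. Qed.

(** With the index shifted by one, both zeros, now at [0] and [n + 2], are terms of the sequence. *)
Let usin (k : nat) : R := sin (theta * k%:R).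

Let usinD k : usin k + usin k.+2 = 2 * cos theta * usin k.+1.
Proof.
have E1 : theta * k%:R = theta * k.+1%:R - theta by rewrite -[in RHS]natr1; ring.
have E2 : theta * k.+2%:R = theta * k.+1%:R + theta by rewrite -[in LHS]natr1; ring.
rewrite /usin E1 E2 sinB sinD; ring.
Qed.

Let usin_ge0 k : (k <= n.+2)%N -> 0 <= usin k.
Proof.
move=> kn; apply: sin_ge0_pi; rewrite mulr_ge0 ?(ltW theta_gt0) //= /theta.
by rewrite -mulrA ler_piMr ?(ltW (pi_gt0 _)) // mulrC ler_pdivrMr // mul1r ler_nat.
Qed.

Let usin_concave k : (k.+2 <= n.+2)%N -> usin k + usin k.+2 <= 2 * usin k.+1.
Proof.
move=> kn; rewrite usinD; have := @usin_ge0 k.+1 (ltnW kn).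
have := cos_le1 theta; nra.
Qed.

(** At an end of the path the missing neighbour would contribute a zero of the sine, so the addition
    formula needs no correction. *)
Lemma sinseq_nbr (k : 'I_n.+1) :
  \sum_(l < n.+1 | (l == k.+1 :> nat) || (k == l.+1 :> nat)) sinseq l =
  2 * cos theta * sinseq k.
Proof.
rewrite -[sinseq k]/(usin k.+1) -usinD.
have E0 : \sum_(l < n.+1 | k == l.+1 :> nat) sinseq l = usin k.
  case: k => -[|k] kn /=; first by rewrite big1 // /usin mulr0 sin0.
  rewrite (bigD1 (Ordinal (ltnW kn))) //= big1 ?addr0 // => l /andP[/eqP E].
  by case: eqP => // H; case: H; apply/val_inj; case: E.
have E1 : \sum_(l < n.+1 | l == k.+1 :> nat) sinseq l = usin k.+2.
  have [kn|kn] := ltnP k.+1 n.+1.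
    rewrite (bigD1 (Ordinal kn)) //= big1 ?addr0 // => l /andP[/eqP E].
    by case: eqP => // H; case: H; apply/val_inj.
  have -> : k.+2 = n.+2 by congr _.+1; apply/eqP; rewrite eqn_leq kn ltn_ord.
  rewrite big1 ?[usin _]sinseq_end // => l /eqP E.
  by have := ltn_ord l; rewrite E ltnNge kn.
rewrite -E0 -E1 addrC (bigID (fun l : 'I__ => l == k.+1 :> nat)) /=; congr (_ + _).
  by apply: eq_bigl => l; case: eqP => _; rewrite ?andbT ?andbF.
apply: eq_bigl => l; case: (eqVneq (l : nat) k.+1) => [->|_]; last by rewrite andbT.
by rewrite andbF; apply/esym/ltn_eqF/leqnSn.
Qed.

(** Angles between [pi / 4] and [3 * pi / 4], where the cosine of the doubled angle is nonpositive
    and so the squared sine is at least [1 / 2]. *)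
Definition middle (k : nat) : bool := (n.+2 <= 4 * k.+1 <= 3 * n.+2)%N.

Lemma sinseq_middle k : middle k -> 2^-1 <= sinseq k.
Proof.
move=> /andP[k1 k2]; set x := theta * k.+1%:R.
have n0 : 0 < n.+2%:R :> R by [].
have x1 : pi / 4 <= x.
  rewrite /x /theta -mulrA ler_pM2l ?pi_gt0 // mulrC ler_pdivlMr //.
  by move: k1; rewrite -(ler_nat R) natrM; lra.
have x2 : x <= 3 * pi / 4.
  rewrite /x /theta -mulrA [3 * pi]mulrC -mulrA ler_pM2l ?pi_gt0 // mulrC ler_pdivrMr //.
  by move: k2; rewrite -(ler_nat R) !natrM; lra.
have c2 : cos (x *+ 2) <= 0.
  have -> : x *+ 2 = (x *+ 2 - pi) + pi by rewrite subrK.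
  rewrite cosDpi oppr_le0; apply: cos_ge0_pihalf; rewrite (mulr2n x); clearbody x.
  by apply/andP; split; lra.
have s0 : 0 <= sin x by apply: sin_ge0_pi; have := @pi_gt0 R; lra.
move: c2; rewrite cos_mulr2n cos2sin2 => c2.
rewrite /sinseq -/x; nra.
Qed.

Let mid := (n.+2 %/ 2)%N.

Let mid_middle : [/\ (0 < mid)%N, (mid <= n.+1)%N & middle mid.-1].
Proof. by split; rewrite /middle /mid; lia. Qed.

(** Concavity between the midpoint, where the sine is at least [1 / 2], and the zero at either
    end. *)
Lemma sinseq_ge k : (k <= n)%N -> (2 * n.+2%:R)^-1 <= sinseq k.
Proof.
move=> kn; have [m0 mn mm] := mid_middle.
have um : 2^-1 <= usin mid by have := sinseq_middle mm; rewrite /sinseq prednK.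
have u0 : 0 <= usin 0 by rewrite usin_ge0.
have ue : 0 <= usin n.+2 by rewrite usin_ge0.
have uk : 0 <= usin k.+1 by rewrite usin_ge0 // ltnS ltnW.
rewrite -[sinseq k]/(usin k.+1) invfM ler_pdivrMr //.
have [km|km] := leqP k.+1 mid.
  have := @concave_seq usin n.+2 0 k.+1 mid usin_concave; rewrite km /= ltnW //.
  move=> /(_ isT isT); rewrite !subn0.
  have H1 : mid%:R <= n.+2%:R :> R by rewrite ler_nat ltnW.
  have H2 : 1 <= k.+1%:R :> R by rewrite ler1n.
  have H3 : 0 <= (mid - k.+1)%:R * usin 0 :> R by rewrite mulr_ge0.
  have H4 : 0 <= (k.+1%:R - 1) * (usin mid - 2^-1) by rewrite mulr_ge0 ?subr_ge0.
  have := ler_wpM2r uk H1; lra.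
have := @concave_seq usin n.+2 mid k.+1 n.+2 usin_concave.
have -> : (mid <= k.+1 <= n.+2)%N by lia.
rewrite leqnn => /(_ isT isT).
have H1 : (n.+2 - mid)%:R <= n.+2%:R :> R by rewrite ler_nat leq_subr.
have H2 : 1 <= (n.+2 - k.+1)%:R :> R by rewrite ler1n; lia.
have H3 : 0 <= (k.+1 - mid)%:R * usin n.+2 :> R by rewrite mulr_ge0.
have H4 : 0 <= ((n.+2 - k.+1)%:R - 1) * (usin mid - 2^-1).
  by rewrite mulr_ge0 ?subr_ge0.
have := ler_wpM2r uk H1; lra.
Qed.

(** Concavity bounds the value from below by the smaller end value, and
    [sinseq j >= 1 / 2 >= sinseq i / 2]. So the eigenfunction loses only a constant factor on the
    way to the middle. *)
Lemma sinseq_between (i j k : nat) : middle j -> (i <= n)%N -> (j <= n)%N ->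
  (i <= k <= j)%N || (j <= k <= i)%N -> 2^-1 * sinseq i <= sinseq k.
Proof.
move=> mj jn kn H; have sj := sinseq_middle mj.
have s1 := sinseq_le1 i; have s0 : 0 < sinseq i by exact: sinseq_gt0.
have C := fun p q r => @concave_seq usin n.+2 p q r usin_concave.
have [E|E] := eqVneq i j.
  have -> : k = i by move: H; rewrite -E; lia.
  lra.
have : 0 < (j - i)%:R + (i - j)%:R :> R by rewrite -natrD ltr0n; lia.
case/orP: H => H.
  have := C i.+1 k.+1 j.+1; rewrite !ltnS H (leq_trans kn (leqnSn _)) => /(_ isT isT).
  rewrite !subSS -![usin _.+1]/(sinseq _).
  have -> : (j - i)%:R = (j - k)%:R + (k - i)%:R :> R by rewrite -natrD; congr _%:R; lia.
  have -> : (i - j = 0)%N by lia.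
  rewrite addr0 => Hc D0.
  have H1 : 0 <= (j - k)%:R * sinseq i by rewrite mulr_ge0 // ltW.
  have H2 : 0 <= (k - i)%:R * (sinseq j - 2^-1 * sinseq i) by rewrite mulr_ge0 //; lra.
  rewrite -(ler_pM2l D0); lra.
have := C j.+1 k.+1 i.+1; rewrite !ltnS H (leq_trans jn (leqnSn _)) => /(_ isT isT).
rewrite !subSS -![usin _.+1]/(sinseq _).
have -> : (i - j)%:R = (i - k)%:R + (k - j)%:R :> R by rewrite -natrD; congr _%:R; lia.
have -> : (j - i = 0)%N by lia.
rewrite add0r => Hc D0.
have H1 : 0 <= (k - j)%:R * sinseq i by rewrite mulr_ge0 // ltW.
have H2 : 0 <= (i - k)%:R * (sinseq j - 2^-1 * sinseq i) by rewrite mulr_ge0 //; lra.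
rewrite -(ler_pM2l D0); lra.
Qed.

End SineSeq.
End Sine.

(** * Boxes and a spectral gap *)

Section Box.
Variables (R : realType) (d n : nat).

Definition box := {ffun 'I_d -> 'I_n.+1}.
Implicit Types (x y v : box) (i j : 'I_d) (k l : 'I_n.+1).

Definition consec (k l : nat) : bool := (l == k.+1) || (k == l.+1).

Definition upd x i k : box := [ffun j => if j == i then k else x j].

Definition box_adj x y : bool :=
  [exists i, consec (x i) (y i) && [forall j, (j != i) ==> (x j == y j)]].

Lemma consecC k l : consec k l = consec l k.
Proof. exact: orbC. Qed.

Lemma consecnn k : consec k k = false.
Proof. by rewrite /consec orbb; apply/negbTE; rewrite neq_ltn leqnn. Qed.

Lemma box_adj_sym : symmetric box_adj.
Proof.
suff H x y : box_adj x y -> box_adj y x by move=> x y; apply/idP/idP; apply: H.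
move=> /existsP[i /andP[c /forallP f]]; apply/existsP; exists i.
by rewrite consecC c /=; apply/forallP => j; rewrite (eq_sym (y j)).
Qed.

Lemma updK x i : upd x i (x i) = x.
Proof. by apply/ffunP => j; rewrite ffunE; case: eqP => [->|]. Qed.

Lemma upd_upd x i k l : upd (upd x i k) i l = upd x i l.
Proof. by apply/ffunP => j; rewrite !ffunE; case: eqP. Qed.

Lemma updE x i k : upd x i k i = k.
Proof. by rewrite ffunE eqxx. Qed.

Lemma upd_neq x i j k : j != i -> upd x i k j = x j.
Proof. by rewrite ffunE => /negbTE ->. Qed.

(** A neighbour is determined by the coordinate that changes and its new value; the pair is unique
    because [consec] is irreflexive. *)
Lemma sum_box_adj (F : box -> R) x :
  \sum_(y | box_adj x y) F y =
  \sum_(i < d) \sum_(k < n.+1 | consec (x i) k) F (upd x i k).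
Proof.
rewrite pair_big_dep /=.
set A := finset (fun p : 'I_d * 'I_n.+1 => consec (x p.1) p.2).
transitivity (\sum_(p in A) F (upd x p.1 p.2)); last first.
  by apply: eq_bigl => p; rewrite inE.
rewrite -(big_imset F (h := fun p : 'I_d * 'I_n.+1 => upd x p.1 p.2)) /=.
  apply: eq_bigl => y; apply/existsP/imsetP => [[i /andP[c /forallP f]]|[[i k]]].
    exists (i, y i); first by rewrite inE.
    apply/ffunP => j; rewrite ffunE /=; case: eqVneq => [->//|ji].
    by have /implyP /(_ ji) /eqP := f j.
  rewrite inE /= => c ->; exists i; rewrite updE c.
  by apply/forallP => j; apply/implyP => ji; rewrite upd_neq.
move=> [i k] [j l] /=; rewrite !inE /= => ci cj E.
have ij : i = j.
  apply/eqP; apply: contraT => ij; move: ci.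
  by move/ffunP: E => /(_ i); rewrite updE upd_neq // => ->; rewrite consecnn.
move: E cj; rewrite -ij => /ffunP /(_ i); rewrite !updE => -> _.
by [].
Qed.

Definition hbox x : R := \prod_i sinseq R n (x i).

Lemma hbox_gt0 x : 0 < hbox x.
Proof. by apply: prodr_gt0 => i _; apply: sinseq_gt0; rewrite -ltnS. Qed.

Lemma hbox_le1 x : hbox x <= 1.
Proof.
apply: prodr_ile1 => i _; rewrite sinseq_le1 ltW //.
by apply: sinseq_gt0; rewrite -ltnS.
Qed.

Lemma hbox_ge x : (2 * n.+2%:R)^-1 ^+ d <= hbox x.
Proof.
rewrite -[d in X in X <= _]card_ord -prodr_const; apply: ler_prod => i _.
by rewrite invr_ge0 mulr_ge0 //= sinseq_ge // -ltnS.
Qed.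

Lemma hbox_upd x i k : hbox (upd x i k) = sinseq R n k * \prod_(j | j != i) sinseq R n (x j).
Proof.
rewrite /hbox (bigD1 i) //= updE; congr (_ * _).
by apply: eq_bigr => j ji; rewrite upd_neq.
Qed.

Definition Lam : R := (2 * d)%:R * cos (theta R n).

Lemma hbox_eigen x : nbr_sum box_adj predT hbox x = Lam * hbox x.
Proof.
rewrite /nbr_sum; under eq_bigl do rewrite andbT.
rewrite sum_box_adj (eq_bigr (fun=> 2 * cos (theta R n) * hbox x)).
  by rewrite sumr_const card_ord -[_ *+ d]mulr_natr /Lam natrM; ring.
move=> i _; under eq_bigr do rewrite hbox_upd.
by rewrite -mulr_suml sinseq_nbr -mulrA -hbox_upd updK.
Qed.

Lemma hbox_half x y :
  (forall i, 2^-1 * sinseq R n (x i) <= sinseq R n (y i)) ->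
  2^-1 ^+ d * hbox x <= hbox y.
Proof.
move=> H; rewrite -[d in X in X <= _]card_ord -prodr_const -big_split /=.
apply: ler_prod => i _; rewrite H andbT mulr_ge0 ?invr_ge0 // ltW //.
by apply: sinseq_gt0; rewrite -ltnS.
Qed.

End Box.

(** * Ground-state transform and energy along lines *)

Section Energy.
Variables (R : realType) (T : finType) (a : rel T).
Hypothesis a_sym : symmetric a.

(** Ground-state transform: [lam - a] becomes a Dirichlet form in [g] with conductances [h x * h y];
    the half compensates for counting each edge in both orientations. *)
Lemma energyE (h g : T -> R) (lam : R) :
    (forall x, nbr_sum a predT h x = lam * h x) ->
  lam * dot (fun x => h x * g x) (fun x => h x * g x)
    - form a (fun x => h x * g x) (fun x => h x * g x) =
  (\sum_x \sum_(y | a x y) h x * h y * (g x - g y) ^+ 2) / 2.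
Proof.
move=> hE.
have E1 : \sum_x \sum_(y | a x y) h x * h y * g x ^+ 2 =
    lam * dot (fun x => h x * g x) (fun x => h x * g x).
  rewrite mulr_sumr; apply: eq_bigr => x _.
  transitivity (h x * g x ^+ 2 * nbr_sum a predT h x); last by rewrite hE; ring.
  rewrite /nbr_sum mulr_sumr; apply: eq_big => [y|y _]; first by rewrite andbT.
  ring.
have E2 : \sum_x \sum_(y | a x y) h x * h y * g y ^+ 2 =
    lam * dot (fun x => h x * g x) (fun x => h x * g x).
  rewrite -E1; under eq_bigr do rewrite big_mkcond.
  rewrite exchange_big; apply: eq_bigr => y _; rewrite [RHS]big_mkcond.
  by apply: eq_bigr => x _; rewrite a_sym [h x * h y]mulrC.
have E3 : \sum_x \sum_(y | a x y) h x * h y * (g x - g y) ^+ 2 =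
   \sum_x \sum_(y | a x y) h x * h y * g x ^+ 2 +
   \sum_x \sum_(y | a x y) h x * h y * g y ^+ 2 -
   2 * form a (fun x => h x * g x) (fun x => h x * g x).
  rewrite formE mulr_sumr -big_split -sumrB; apply: eq_bigr => x _ /=.
  rewrite mulr_sumr -big_split -sumrB; apply: eq_bigr => y _ /=; ring.
by rewrite E3 E1 E2; field.
Qed.
End Energy.

Section Line.
Variable R : realType.

Lemma ler_sum_inj (I J : finType) (f : I -> J) (F : J -> R) :
  injective f -> (forall j, 0 <= F j) -> \sum_i F (f i) <= \sum_j F j.
Proof.
move=> fi F0; rewrite -(big_imset F (h := f) (A := predT)) /=; last first.
  by move=> x y _ _; apply: fi.
by rewrite [leRHS](bigID (mem (imset f (mem predT)))) /= lerDl sumr_ge0.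
Qed.

Lemma telescope_CS (u : nat -> R) p :
  (u p - u 0%N) ^+ 2 <= p%:R * \sum_(i < p) (u i.+1 - u i) ^+ 2.
Proof.
elim: p => [|p IH]; first by rewrite subrr expr0n mul0r.
rewrite big_ord_recr /=; set S := \sum_(i < p) _ in IH *.
have -> : u p.+1 - u 0%N = (u p - u 0%N) + (u p.+1 - u p) by ring.
set x := u p - _ in IH *; set y := u p.+1 - _.
have S0 : 0 <= S by apply: sumr_ge0 => i _; exact: sqr_ge0.
case: p @x @y @S IH S0 => [|p] x y S IH S0.
  by have -> : x = 0 by [rewrite /x subrr]; rewrite /S big_ord0 !add0r mul1r.
rewrite -[p.+2%:R]natr1; set q : R := p.+1%:R in IH *.
have q0 : 0 < q by [].
rewrite -subr_ge0 -(pmulr_rge0 _ q0).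
have H : 0 <= (q + 1) * (q * S - x ^+ 2) by rewrite mulr_ge0 ?subr_ge0 // ltW // addr_gt0.
have := sqr_ge0 (x - q * y); nra.
Qed.

(** Each edge of the segment has conductance at least [c ^+ 2], and Cauchy-Schwarz along it costs
    its length, at most [wid]. *)
Lemma line_bound n (u w : 'I_n.+1 -> R) (k0 k1 : 'I_n.+1) (c : R) (wid : nat) :
    0 <= c -> (forall k, 0 <= w k) ->
    (forall k : 'I_n.+1, (k0 <= k <= k1)%N || (k1 <= k <= k0)%N -> c <= w k) ->
    (k0 - k1 <= wid)%N -> (k1 - k0 <= wid)%N ->
  c ^+ 2 * (u k0 - u k1) ^+ 2 <=
  wid%:R * \sum_(k < n.+1) \sum_(l < n.+1 | consec k l) w k * w l * (u k - u l) ^+ 2.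
Proof.
move=> c0 w0; wlog kk : k0 k1 / (k0 <= k1)%N => [H cw w1 w2|cw _ wid1].
  have [kk|/ltnW kk] := leqP k0 k1; first exact: H.
  rewrite -(sqrrN (u k0 - _)) opprB; apply: H => // k Hk; apply: cw.
  by rewrite orbC.
pose p := (k1 - k0)%N; pose U i := u (inord (k0 + i)).
have kp : (k0 + p)%N = k1 by rewrite /p subnKC.
have val_in i : (i <= p)%N -> (inord (k0 + i) : 'I_n.+1) = (k0 + i)%N :> nat.
  by move=> ip; rewrite inordK // ltnS -ltnS; have := ltn_ord k1; lia.
have -> : u k0 - u k1 = - (U p - U 0%N).
  rewrite opprB /U; congr (u _ - u _); apply/val_inj; rewrite /= val_in //.
  by rewrite addn0.
rewrite sqrrN; set E := \sum_(k < n.+1) _.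
have w2 k l : 0 <= w k * w l * (u k - u l) ^+ 2.
  by rewrite mulr_ge0 ?sqr_ge0 // mulr_ge0.
have E0 : 0 <= E by apply: sumr_ge0 => k _; apply: sumr_ge0.
apply: (@le_trans _ _ (p%:R * E)); last by rewrite ler_wpM2r // ler_nat.
apply: le_trans (ler_wpM2l (sqr_ge0 c) (telescope_CS U p)) _.
rewrite mulrCA ler_wpM2l // mulr_sumr.
apply: le_trans (ler_sum_inj (f := fun i : 'I_p => inord (k0 + i) : 'I_n.+1) _ _).
- apply: ler_sum => i _.
  have i1 := ltn_ord i.
  rewrite (bigD1 (inord (k0 + i.+1))) /=; last first.
    by rewrite /consec !val_in ?(ltnW i1) // addnS eqxx.
  apply: ler_wpDr; first exact: sumr_ge0.
  rewrite -(sqrrN (U i.+1 - _)) opprB ler_wpM2r ?sqr_ge0 // expr2.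
  by apply: ler_pM => //; apply: cw; rewrite val_in ?(ltnW i1) //; lia.
- move=> i j /(congr1 val) /=; rewrite !val_in 1?ltnW // => H.
  by apply/val_inj => /=; apply/eqP; rewrite -(eqn_add2l k0); apply/eqP.
- by move=> k; apply: sumr_ge0.
Qed.
End Line.

Section BoxEnergy.
Variables (R : realType) (d n : nat) (g : box d n -> R).
Local Notation h := (hbox R (d := d) (n := n)).
Implicit Types (x y v : box d n) (i j : 'I_d) (k l : 'I_n.+1).

Definition edge_energy x y : R := h x * h y * (g x - g y) ^+ 2.

Definition dir_energy i x : R :=
  \sum_(k < n.+1 | consec (x i) k) edge_energy x (upd x i k).

Definition box_energy : R := \sum_x \sum_i dir_energy i x.

Definition line_energy i y : R := \sum_(k < n.+1) dir_energy i (upd y i k).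

Lemma edge_energy_ge0 x y : 0 <= edge_energy x y.
Proof. by rewrite mulr_ge0 ?sqr_ge0 // mulr_ge0 // ltW // hbox_gt0. Qed.

Lemma dir_energy_ge0 i x : 0 <= dir_energy i x.
Proof. by apply: sumr_ge0 => k _; exact: edge_energy_ge0. Qed.

Lemma box_energyE :
  box_energy = \sum_x \sum_(y | box_adj x y) h x * h y * (g x - g y) ^+ 2.
Proof.
by apply: eq_bigr => x _; rewrite (sum_box_adj (fun y => edge_energy x y)).
Qed.

Lemma box_energy_ge0 : 0 <= box_energy.
Proof. by apply: sumr_ge0 => x _; apply: sumr_ge0 => i _; exact: dir_energy_ge0. Qed.

Lemma upd_inj y i : injective (upd y i).
Proof. by move=> k l /ffunP /(_ i); rewrite !updE. Qed.

Lemma line_energy_le i y : line_energy i y <= box_energy.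
Proof.
apply: le_trans (ler_sum_inj (f := upd y i)
  (F := fun x => \sum_i dir_energy i x) _ _); last first.
- by move=> x; apply: sumr_ge0 => j _; exact: dir_energy_ge0.
- exact: upd_inj.
apply: ler_sum => k _; rewrite (bigD1 i) //= lerDl.
by apply: sumr_ge0 => j _; exact: dir_energy_ge0.
Qed.

(** Edges leaving the hyperplane in direction [i0] are included, so that the slices add up exactly
    to the whole energy. *)
Definition slice_energy i0 k : R := \sum_(x : box d n | x i0 == k) \sum_i dir_energy i x.

Lemma sum_slice_energy i0 : \sum_k slice_energy i0 k = box_energy.
Proof.
rewrite /slice_energy /box_energy.
by rewrite [RHS](partition_big (fun x : box d n => x i0) predT).
Qed.

Lemma slice_energy_ge0 i0 k : 0 <= slice_energy i0 k.
Proof. by apply: sumr_ge0 => x _; apply: sumr_ge0 => i _; exact: dir_energy_ge0. Qed.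

Lemma line_energy_slice i0 i y : i != i0 ->
  line_energy i y <= slice_energy i0 (y i0).
Proof.
move=> ii0; pose F x : R := if x i0 == y i0 then \sum_i dir_energy i x else 0.
rewrite /slice_energy big_mkcond.
apply: le_trans (ler_sum_inj (f := upd y i) (F := F) _ _); last first.
- move=> x; rewrite /F; case: ifP => // _.
  by apply: sumr_ge0 => j _; exact: dir_energy_ge0.
- exact: upd_inj.
apply: ler_sum => k _; rewrite /F upd_neq 1?eq_sym // eqxx (bigD1 i) //= lerDl.
by apply: sumr_ge0 => j _; exact: dir_energy_ge0.
Qed.

(** Every line in direction [i] occurs once for each of its [n.+1] points. *)
Lemma sum_line_energy i : \sum_y line_energy i y <= n.+1%:R * box_energy.
Proof.
have -> : \sum_y line_energy i y = n.+1%:R * \sum_x dir_energy i x.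
  (* Lines are indexed by their point whose coordinate [i] is zero. *)
  rewrite /line_energy (partition_big (fun y : box d n => upd y i ord0) (fun z => z i == ord0)) /=;
    last by move=> y _; rewrite updE.
  rewrite [X in _ = _ * X](partition_big (fun y : box d n => upd y i ord0) (fun z => z i == ord0)) /=;
    last by move=> y _; rewrite updE.
  rewrite mulr_sumr; apply: eq_bigr => z /eqP zi.
  have key (F : box d n -> R) : \sum_(y | upd y i ord0 == z) F y = \sum_k F (upd z i k).
    rewrite (reindex_onto (fun k => upd z i k) (fun y : box d n => y i)) /=.
      apply: eq_bigl => k; rewrite upd_upd updE eqxx andbT.
      by apply/eqP; rewrite -zi updK.
    by move=> y /eqP <-; rewrite upd_upd updK.
  rewrite !key; under eq_bigr => k _ do
    (under eq_bigr => l _ do rewrite upd_upd).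
  by rewrite sumr_const card_ord mulr_natl.
rewrite ler_wpM2l //; apply: ler_sum => x _; rewrite (bigD1 i) //= lerDl.
by apply: sumr_ge0 => j _; exact: dir_energy_ge0.
Qed.

Lemma move_coord i y (k0 k1 : 'I_n.+1) (c : R) (wid : nat) :
    0 <= c ->
    (forall k : 'I_n.+1, (k0 <= k <= k1)%N || (k1 <= k <= k0)%N -> c <= h (upd y i k)) ->
    (k0 - k1 <= wid)%N -> (k1 - k0 <= wid)%N ->
  c ^+ 2 * (g (upd y i k0) - g (upd y i k1)) ^+ 2 <= wid%:R * line_energy i y.
Proof.
move=> c0 cw w1 w2.
have := @line_bound R n (fun k => g (upd y i k)) (fun k => h (upd y i k)) k0 k1 c wid
  c0 (fun k => ltW (hbox_gt0 _ _)) cw w1 w2.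
move=> H; apply: le_trans H _; rewrite ler_wpM2l //.
apply: ler_sum => k _; rewrite /dir_energy updE; apply: ler_sum => l _.
by rewrite upd_upd.
Qed.

(** The [w] slices together carry at most the total energy, so one carries at most the average. *)
Lemma slice_pigeonhole i0 (k0 w : nat) : (k0 + w <= n.+1)%N -> (0 < w)%N ->
  exists k : 'I_n.+1, (k0 <= k < k0 + w)%N /\ w%:R * slice_energy i0 k <= box_energy.
Proof.
move=> kw w0; apply: contrapT => /forallNP H.
suff : box_energy < box_energy by rewrite ltxx.
have B (q : nat) : (q < w)%N -> (k0 + q < n.+1)%N.
  by move=> iw; apply: leq_trans kw; rewrite ltn_add2l.
pose f (q : 'I_w) : 'I_n.+1 := Ordinal (B q (ltn_ord q)).
have fi : injective f by move=> q r [/addnI] /val_inj.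
rewrite -{2}(sum_slice_energy i0).
apply: lt_le_trans (ler_sum_inj fi (slice_energy_ge0 i0)).
have Hi q : box_energy < w%:R * slice_energy i0 (f q).
  rewrite ltNge; apply/negP => Hc; apply: (H (f q)); split=> //=.
  by rewrite leq_addr ltn_add2l ltn_ord.
case: w w0 kw {H} B f fi Hi => // w _ _ B f fi Hi.
have -> : box_energy = \sum_(i < w.+1) (box_energy / w.+1%:R).
  by rewrite sumr_const card_ord -[RHS]mulr_natr divfK.
apply: ltr_sum => //; first by apply/hasP; exists ord0; rewrite ?mem_index_enum.
by move=> i _; rewrite ltr_pdivrMr // mulrC.
Qed.

End BoxEnergy.

(** * Poincare inequality for functions vanishing at a point *)

Section BoxGap.
Variables (R : realType) (d n : nat) (g : box d n -> R).
Local Notation h := (hbox R (d := d) (n := n)).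
Local Notation s := (sinseq R n).
Variables (v : box d n) (i0 : 'I_d) (w : nat).
Hypotheses (w0 : (0 < w)%N) (mv : forall i, middle n (v i))
  (mw : forall k : nat, (v i0 <= k < v i0 + w)%N -> middle n k)
  (vw : (v i0 + w <= n.+1)%N) (gv : g v = 0).

Let s_gt0 (k : 'I_n.+1) : 0 < s k.
Proof. by apply: sinseq_gt0; rewrite -ltnS. Qed.

Let half_le (k : 'I_n.+1) : 2^-1 * s k <= s k.
Proof. by have := s_gt0 k; lra. Qed.

Let half_middle (k : 'I_n.+1) (l : nat) : middle n l -> 2^-1 * s k <= s l.
Proof.
by move=> /(sinseq_middle R); have := sinseq_le1 R n k; have := s_gt0 k; lra.
Qed.

Let half_between (k l m : 'I_n.+1) : middle n l ->
  (k <= m <= l)%N || (l <= m <= k)%N -> 2^-1 * s k <= s m.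
Proof.
move=> ml H; apply: (@sinseq_between R n k l m) => //; rewrite -ltnS; exact: ltn_ord.
Qed.

(* The path from [x] to [v] first moves coordinate [i0] into a slice of small
   energy, then moves the other coordinates inside that slice, and finally moves
   coordinate [i0] to [v i0] over a distance less than [w]. *)
Lemma point_energy (m : 'I_n.+1) (x : box d n) : (v i0 <= m < v i0 + w)%N ->
  (2^-1 ^+ d * h x) ^+ 2 * g x ^+ 2 <=
  3 * (n.+1%:R * line_energy g i0 x
       + d%:R * (d%:R * (n.+1%:R * slice_energy g i0 m))
       + w%:R * box_energy g).
Proof.
move=> Hm; have mm := mw Hm.
set c := 2^-1 ^+ d * h x.
have c0 : 0 <= c by rewrite mulr_ge0 ?exprn_ge0 // ltW // hbox_gt0.
have small (k l : 'I_n.+1) : (k - l <= n.+1)%N.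
  by apply: leq_trans (leq_subr _ _) _; rewrite ltnW.
pose x1 := upd x i0 m; pose v1 := upd v i0 m.
have H1 : c ^+ 2 * (g x - g x1) ^+ 2 <= n.+1%:R * line_energy g i0 x.
  rewrite -{1}(updK x i0); apply: move_coord => // k Hk.
  apply: hbox_half => i; rewrite ffunE; case: eqP => [->|_]; last exact: half_le.
  exact: half_between Hk.
have H3 : c ^+ 2 * (g v1 - g v) ^+ 2 <= w%:R * box_energy g.
  apply: (@le_trans _ _ (w%:R * line_energy g i0 v)); last first.
    by rewrite ler_wpM2l // line_energy_le.
  have := @move_coord R d n g i0 v m (v i0) c w c0; rewrite updK.
  apply; try lia.
  move=> k Hk; apply: hbox_half => i; rewrite ffunE; case: eqP => _.
    by apply: half_middle; apply: mw; lia.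
  exact: half_middle.
(* Interpolation inside the slice: the coordinates before [j] already have their target values. *)
pose y (j : nat) : box d n := [ffun i : 'I_d => if (i < j)%N then v1 i else x1 i].
have y0 : y 0%N = x1 by apply/ffunP => i; rewrite ffunE ltn0.
have yd : y d = v1 by apply/ffunP => i; rewrite ffunE ltn_ord.
have yS (j : 'I_d) : y j.+1 = upd (y j) j (v1 j).
  apply/ffunP => i; rewrite !ffunE ltnS leq_eqVlt.
  have [->|ij] := eqVneq i j; first by rewrite eqxx.
  by rewrite (negbTE (ij : (i : nat) != j)).
have yi0 j : y j i0 = m by rewrite ffunE !updE; case: ifP.
have H2 : c ^+ 2 * (g v1 - g x1) ^+ 2 <=
    d%:R * (d%:R * (n.+1%:R * slice_energy g i0 m)).
  rewrite -y0 -yd.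
  apply: le_trans (ler_wpM2l (sqr_ge0 c) (telescope_CS (fun j => g (y j)) d)) _.
  rewrite mulrCA ler_wpM2l // mulr_sumr.
  have -> : d%:R * (n.+1%:R * slice_energy g i0 m) =
      \sum_(j < d) (n.+1%:R * slice_energy g i0 m).
    by rewrite sumr_const card_ord mulr_natl.
  apply: ler_sum => j _; have [ji|ji] := eqVneq j i0.
    have -> : y j.+1 = y j by rewrite yS ji /v1 updE -(yi0 j) ji updK.
    by rewrite subrr expr0n mulr0 mulr_ge0 // slice_energy_ge0.
  apply: (@le_trans _ _ (n.+1%:R * line_energy g j (y j))); last first.
    by rewrite ler_wpM2l // -(yi0 j) line_energy_slice.
  rewrite -(sqrrN (g _ - g _)) opprB yS -{1}(updK (y j) j).
  have -> : y j j = x j by rewrite !ffunE ltnn (negbTE ji).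
  have v1j : v1 j = v j by rewrite ffunE (negbTE ji).
  rewrite v1j; apply: move_coord => // k Hk.
  apply: hbox_half => i; rewrite ffunE; case: eqP => [->|_].
    exact: half_between Hk.
  rewrite ffunE; case: ifP => _; rewrite ffunE; case: eqP => [_|_].
  - exact: half_middle.
  - exact: half_middle.
  - exact: half_middle.
  - exact: half_le.
have -> : g x = (g x - g x1) - (g v1 - g x1) + (g v1 - g v) by rewrite gv; ring.
move: H1 H2 H3; set A := g x - g x1; set B := g v1 - g x1; set C := g v1 - g v.
have H : (A - B + C) ^+ 2 <= 3 * (A ^+ 2 + B ^+ 2 + C ^+ 2).
  by have := sqr_ge0 (A + B); have := sqr_ge0 (A - C); have := sqr_ge0 (B + C); nra.
have := ler_wpM2l (sqr_ge0 c) H; nra.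
Qed.

(** Summing [point_energy] over [x], the lines in direction [i0] give a factor [N] and the other
    terms the number [N ^+ d] of points; the slice chosen has [w * S <= E]. *)
Lemma box_gap : (1 < d)%N ->
  w%:R * \sum_x (h x * g x) ^+ 2 <=
  3 * 4 ^+ d * n.+1%:R ^+ d * (w%:R + d%:R ^+ 2 * n.+1%:R + w%:R ^+ 2) * box_energy g.
Proof.
move=> d2; have [m [Hm HS]] := slice_pigeonhole g i0 vw w0.
set E := box_energy g in HS *; set S := slice_energy g i0 m in HS *.
have E0 : 0 <= E := box_energy_ge0 g.
set N : R := n.+1%:R.
have N1 : 1 <= N by rewrite ler1n.
have H : 2^-1 ^+ d ^+ 2 * \sum_x (h x * g x) ^+ 2 <=
   3 * (N * (N * E) + N ^+ d * (d%:R * (d%:R * (N * S)) + w%:R * E)).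
  rewrite mulr_sumr.
  apply: (@le_trans _ _ (\sum_(x : box d n) 3 * (N * line_energy g i0 x
       + d%:R * (d%:R * (N * S)) + w%:R * E))).
    apply: ler_sum => x _; apply: le_trans (point_energy x Hm).
    by rewrite -exprMn -exprMn mulrA.
  rewrite -mulr_sumr ler_wpM2l //.
  under eq_bigr do rewrite -addrA.
  rewrite big_split /= -mulr_sumr sumr_const card_ffun !card_ord -natrX -[_ *+ _]mulr_natl.
  rewrite natrX lerD2r ler_wpM2l //.
  exact: sum_line_energy.
(* Here [2 <= d] lets the line term be absorbed into the volume factor. *)
have N2 : N * N <= N ^+ d by rewrite -expr2 ler_weXn2l.
have Nd : 0 <= N ^+ d by rewrite exprn_ge0 // (le_trans ler01).
have P4 : 0 <= 4 ^+ d * w%:R :> R by rewrite mulr_ge0 ?exprn_ge0.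
have := ler_wpM2l P4 H.
have -> : 4 ^+ d * w%:R * (2^-1 ^+ d ^+ 2 * \sum_x (h x * g x) ^+ 2) =
   w%:R * \sum_x (h x * g x) ^+ 2.
  have -> : (4 : R) = 2 ^+ 2 by rewrite -natrX.
  have E1 : 2 ^+ 2 ^+ d * 2^-1 ^+ d ^+ 2 = 1 :> R.
    by rewrite [2 ^+ 2 ^+ d]exprAC -!exprMn mulfV // !expr1n.
  by rewrite mulrAC mulrA E1 mul1r mulrC.
move=> /le_trans; apply.
have Q1 : w%:R * (N * (N * E)) <= N ^+ d * (w%:R * E).
  have -> : w%:R * (N * (N * E)) = N * N * (w%:R * E) by ring.
  by rewrite ler_wpM2r // mulr_ge0.
have Q2 : w%:R * (N ^+ d * (d%:R * (d%:R * (N * S)) + w%:R * E)) <=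
    N ^+ d * (d%:R ^+ 2 * N * E + w%:R ^+ 2 * E).
  rewrite mulrCA ler_wpM2l // mulrDr; apply: lerD; last by rewrite mulrA expr2.
  have -> : w%:R * (d%:R * (d%:R * (N * S))) = d%:R ^+ 2 * N * (w%:R * S) by ring.
  by rewrite ler_wpM2l // mulr_ge0 ?exprn_ge0 // (le_trans ler01).
have P34 : 0 <= 3 * 4 ^+ d :> R by rewrite mulr_ge0 ?exprn_ge0.
have := ler_wpM2l P34 (lerD Q1 Q2).
by congr (_ <= _); ring.
Qed.

End BoxGap.

(** * Loops covering the core of a box *)

Section Numerics.
Variable R : realType.

Lemma expR_pow_ge (k : nat) (x : R) : 0 <= x -> (x / k.+1%:R) ^+ k.+1 <= expR x.
Proof.
move=> x0; have {2}-> : x = k.+1%:R * (x / k.+1%:R) by rewrite mulrC divfK.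
rewrite expRM_natl ler_pXn2r ?nnegrE ?expR_ge0 ?divr_ge0 //.
by apply: le_trans (expR_ge1Dx _); rewrite lerDr.
Qed.

(** The power of degree [k + 1] in [expR_pow_ge] has a spare factor [a], which exceeds any constant
    for large [a]. *)
Lemma poly_le_expR (c K : R) (k : nat) : 0 < c ->
  exists a0 : nat, forall a : nat, (a0 <= a)%N -> K * a%:R ^+ k <= expR (c * a%:R).
Proof.
move=> c0; pose B := K * (k.+1%:R / c) ^+ k.+1.
exists (Num.bound `|B|) => a ha.
have aB : B <= a%:R.
  apply: le_trans (ler_norm _) _; apply: ltW; apply: lt_le_trans (archi_boundP _) _ => //.
  by rewrite ler_nat.
have ca0 : 0 <= c * a%:R by rewrite mulr_ge0 // ltW.
apply: le_trans (expR_pow_ge k ca0).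
have q0 : 0 < (c / k.+1%:R) ^+ k.+1 by rewrite exprn_gt0 // divr_gt0.
have -> : c * a%:R / k.+1%:R = c / k.+1%:R * a%:R by rewrite mulrAC.
rewrite exprMn [a%:R ^+ k.+1]exprS mulrA ler_wpM2r ?exprn_ge0 // -ler_pdivrMl //.
by rewrite -exprVn invf_div mulrC.
Qed.

Lemma expRN2_le (y : R) : 0 <= y <= 2^-1 -> expR (- (2 * y)) <= 1 - y.
Proof.
move=> /andP[y0 y1]; rewrite expRN invf_ple ?posrE ?expR_gt0 //; last lra.
apply: le_trans (expR_ge1Dx _); rewrite -[_^-1]mul1r ler_pdivrMr; last lra.
nra.
Qed.
End Numerics.

Section BoxLoops.
Variable R : realType.

(** As [pi <= 4], the angle is at most [q^-1]; and [expR (- theta ^ 2) <= 1 - theta ^ 2 / 2 <= cos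
    theta] for angles up to [1]. *)
Lemma cos_theta_ge (n : nat) (q : R) : 4 * q <= n.+2%:R -> 0 < q ->
  4 <= n.+2%:R :> R ->
  expR (- q ^- 2) <= cos (theta R n).
Proof.
move=> qn q0 n4; have t0 := theta_gt0 R n; have t1 := theta_le R n.
have pi4 : pi <= 4 :> R by have := @pihalf_lt2 R; lra.
have n0 : 0 < n.+2%:R :> R by [].
have tq : theta R n <= q^-1.
  rewrite /theta ler_pdivrMr // mulrC ler_pdivlMr //; nra.
have t2 : theta R n <= 1 by rewrite /theta ler_pdivrMr // mul1r; lra.
apply: le_trans (cos_ge _); last by have := @pi_gt0 R; lra.
apply: le_trans (expRN2_le _); last by nra.
rewrite ler_expR lerN2 mulrC divfK // -exprVn ler_pXn2r // nnegrE ?invr_ge0 ltW //.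
Qed.

Section Gap.
Variables (d n w : nat).
Hypotheses (d2 : (1 < d)%N) (w0 : (0 < w)%N).

Definition gap_const : R :=
  3 * 4 ^+ d * n.+1%:R ^+ d * (w%:R + d%:R ^+ 2 * n.+1%:R + w%:R ^+ 2).

(** The relative gap: [box_gap] bounds [w * dot f f] by [gap_const * box_energy], the energy counts
    edges twice, and [Lam] is at most [2 * d]. *)
Definition gap_rate : R := w%:R / (2 * gap_const * (2 * d)%:R).

Lemma gap_const_gt0 : 0 < gap_const.
Proof.
have [p1 p2 p3] : [/\ 0 < 4 ^+ d :> R, 0 < n.+1%:R ^+ d :> R & 0 < w%:R :> R].
  by rewrite !exprn_gt0 // ltr0n.
by rewrite !mulr_gt0 // ltr_wpDr ?exprn_ge0 // ltr_pwDl // mulr_ge0.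
Qed.

(** With [f = h * g], the ground-state transform and [box_gap] give the factor [1 - gap_rate], which
    is at most [expR (- gap_rate)]. *)
Lemma box_form_le_off (v : box d n) (i0 : 'I_d) :
    (forall i, middle n (v i)) ->
    (forall k : nat, (v i0 <= k < v i0 + w)%N -> middle n k) ->
    (v i0 + w <= n.+1)%N ->
  form_le_off (@box_adj d n) v (Lam R d n * expR (- gap_rate)).
Proof.
move=> mv mw vw f fv; pose g x := f x / hbox R x.
have h0 x : hbox R x != 0 by rewrite gt_eqF ?hbox_gt0.
have fE : f = fun x : box d n => hbox R x * g x.
  by apply: funext => x; rewrite /g mulrC divfK.
have gv : g v = 0 by rewrite /g fv mul0r.
have G := box_gap w0 mv mw vw gv d2; have K0 := gap_const_gt0.
have D := energyE (@box_adj_sym d n) g (@hbox_eigen R d n).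
rewrite -fE -[X in _ = X / 2]box_energyE in D.
have ff : \sum_x (hbox R x * g x) ^+ 2 = dot f f.
  by rewrite [in RHS]fE; apply: eq_bigr => x _; rewrite expr2.
rewrite ff -/gap_const in G.
have d0 : 0 < (2 * d)%:R :> R by rewrite ltr0n muln_gt0 /= ltnW.
have L0 : 0 <= Lam R d n by rewrite mulr_ge0 ?cos_theta_ge0.
have L1 : Lam R d n <= (2 * d)%:R by rewrite ler_piMr ?cos_le1.
have n0 := dot_ge0 f.
have R0 : 0 <= gap_rate by rewrite divr_ge0 // mulr_ge0 // ltW // mulr_gt0.
have E1 : gap_rate * (2 * d)%:R * dot f f <= box_energy g / 2.
  have -> : gap_rate * (2 * d)%:R * dot f f = w%:R * dot f f / gap_const / 2.
    by rewrite /gap_rate; field; rewrite gt_eqF /=; [rewrite pnatr_eq0; lia|exact: K0].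
  by rewrite ler_pM2r ?invr_gt0 // ler_pdivrMr // [leRHS]mulrC.
have -> : form (box_adj (n:=n)) f f = Lam R d n * dot f f - box_energy g / 2.
  by rewrite -D opprB addrC subrK.
have H1 : 1 - gap_rate <= expR (- gap_rate) := expR_ge1Dx _.
apply: (@le_trans _ _ (Lam R d n * (1 - gap_rate) * dot f f)); last first.
  by rewrite ler_wpM2r // ler_wpM2l.
have : Lam R d n * gap_rate * dot f f <= gap_rate * (2 * d)%:R * dot f f.
  by rewrite ler_wpM2r // mulrC ler_wpM2l.
nra.
Qed.

End Gap.
End BoxLoops.

Section BoxLoopCount.
Variables (R : realType) (d : nat).
Hypothesis d2 : (1 < d)%N.

Definition box_core (n rho r : nat) : seq (box d n) :=
  [seq v : box d n <- enum {: box d n} | [forall i, (rho - r <= v i <= rho + r)%N]].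

Lemma dot_hbox_le n : dot (@hbox R d n) (@hbox R d n) <= n.+1%:R ^+ d.
Proof.
rewrite -natrX -[d in X in _ <= X]card_ord -[n.+1 in X in _ <= X]card_ord -card_ffun.
rewrite -sum1_card natr_sum; apply: ler_sum => x _.
have := hbox_le1 R x; have := hbox_gt0 R x; nra.
Qed.

Lemma dot_hbox_gt0 n : 0 < dot (@hbox R d n) (@hbox R d n).
Proof.
have p (x : box d n) : 0 < hbox R x * hbox R x by rewrite mulr_gt0 ?hbox_gt0.
rewrite /dot (bigD1 [ffun=> ord0]) //= ltr_pwDl // sumr_ge0 // => x _.
exact: ltW.
Qed.

Lemma size_box_core n rho r : (size (box_core n rho r) <= n.+1 ^ d)%N.
Proof.
rewrite size_filter; apply: leq_trans (count_size _ _) _.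
by rewrite -cardE card_ffun !card_ord.
Qed.

(** With [w = a ^ 2] and side [O(a ^ 4)], [gap_const] is [O(a ^ (4 * d + 4))], so
    [2 * a ^ (4 * d + 3)] steps gain an exponent of order [a]. *)
Lemma gap_rate_ge (n a : nat) : (0 < a)%N -> (n.+1 <= 131 * a ^ 4)%N ->
  ((2 * d)%:R * (3 * 4 ^+ d * 131 ^+ d * (2 + 131 * d%:R ^+ 2)))^-1 * a%:R
    <= (a ^ (4 * d + 3) + a ^ (4 * d + 3))%:R * gap_rate R d n (a ^ 2).
Proof.
move=> a0 na; set G := 3 * 4 ^+ d * 131 ^+ d * (2 + 131 * d%:R ^+ 2).
have A0 : 0 < a%:R :> R by rewrite ltr0n.
have A1 : 1 <= a%:R :> R by rewrite ler1n.
have d0 : 0 < (2 * d)%:R :> R by rewrite ltr0n; lia.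
have na' : n.+1%:R <= 131 * a%:R ^+ 4 :> R by rewrite -natrX -natrM ler_nat.
have n0 : 0 < n.+1%:R :> R by [].
have w0 : (0 < a ^ 2)%N by rewrite expn_gt0 a0.
have gc0 := @gap_const_gt0 R d n _ w0.
have D2 : 0 <= d%:R ^+ 2 :> R by rewrite exprn_ge0.
have gcle : gap_const R d n (a ^ 2) <= G * a%:R ^+ (4 * d + 4).
  have -> : G * a%:R ^+ (4 * d + 4) =
      3 * 4 ^+ d * (131 * a%:R ^+ 4) ^+ d * ((2 + 131 * d%:R ^+ 2) * a%:R ^+ 4).
    by rewrite exprMn -exprM exprD /G; ring.
  rewrite /gap_const natrX; apply: ler_pM.
  - by rewrite !mulr_ge0 ?exprn_ge0.
  - by rewrite !addr_ge0 ?mulr_ge0 ?exprn_ge0.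
  - rewrite ler_wpM2l ?mulr_ge0 ?exprn_ge0 //.
    by apply: lerXn2r; rewrite ?nnegrE ?mulr_ge0 ?exprn_ge0.
  have E : a%:R ^+ 2 ^+ 2 = a%:R ^+ 4 :> R by rewrite -exprM.
  have H2 : a%:R ^+ 2 <= a%:R ^+ 4 :> R by rewrite ler_weXn2l.
  rewrite E; have := ler_wpM2l D2 na'; lra.
have G0 : 0 < G.
  by rewrite /G !mulr_gt0 ?exprn_gt0 // ltr_wpDr // mulr_ge0.
have E : (a ^ (4 * d + 3) + a ^ (4 * d + 3))%:R * (a ^ 2)%:R =
   2 * (a%:R ^+ (4 * d + 4) * a%:R) :> R.
  by rewrite natrD !natrX !exprD; ring.
have den0 : 0 < 2 * gap_const R d n (a ^ 2) * (2 * d)%:R.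
  by rewrite mulr_gt0 // pmulr_rgt0.
rewrite /gap_rate [leRHS]mulrA E ler_pdivlMr //.
rewrite [_^-1 * _]mulrC mulrAC ler_pdivrMr ?mulr_gt0 //.
have := ler_wpM2l (ltW (mulr_gt0 A0 d0)) gcle; nra.
Qed.

Lemma middle_near (q w rho k : nat) : (0 < q)%N -> (2 * w <= q)%N -> (3 * q <= rho)%N ->
  (rho - q <= k < rho + q + w)%N -> middle (2 * rho) k.
Proof. by rewrite /middle => q0 wq qr /andP[k1 k2]; apply/andP; split; lia. Qed.

Lemma core_fits (q w rho : nat) : (2 * w <= q)%N -> (3 * q <= rho)%N -> (q + w <= rho)%N.
Proof. lia. Qed.

Lemma box_scale (q rho : nat) : (1 < q)%N -> (3 * q <= rho <= 65 * q)%N ->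
  [/\ (4 * q <= (2 * rho).+2)%N, (4 <= (2 * rho).+2)%N,
      (2 * (2 * rho).+2 <= 264 * q)%N & ((2 * rho).+1 <= 131 * q)%N].
Proof. by move=> q1 /andP[r1 r2]; split; lia. Qed.

(** Confinement of [M] steps costs [M / A ^+ 8 = 2 * A ^+ (4 * d - 5)] in the exponent. Returning to
    [x] costs a power of [A], and the union bound over the core succeeds once [expR (c * A)] beats
    such powers. *)
Lemma box_loops : exists (a0 : nat) (C : R), [/\ (1 < a0)%N, 0 < C &
  forall a rho : nat, (a0 <= a)%N -> (3 * a ^ 4 <= rho <= 65 * a ^ 4)%N ->
  forall x : box d (2 * rho),
  expR (- (C * a%:R ^+ (4 * d - 5)))
    * (2 * d)%:R ^+ (a ^ (4 * d + 3) + a ^ (4 * d + 3)) <=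
  (count (fun p => (last x p == x)
                   && all (fun v => v \in x :: p) (box_core (2 * rho) rho (a ^ 4)))
         (walks (@box_adj d (2 * rho)) (a ^ (4 * d + 3) + a ^ (4 * d + 3)) x))%:R].
Proof.
have [E8 E9] : (4 * d - 5 + 8 = 4 * d + 3)%N /\ (1 <= 4 * d - 5)%N by lia.
have d0 : 0 < (2 * d)%:R :> R by rewrite ltr0n; lia.
pose c : R := ((2 * d)%:R * (3 * 4 ^+ d * 131 ^+ d * (2 + 131 * d%:R ^+ 2)))^-1.
have c0 : 0 < c.
  by rewrite invr_gt0 !mulr_gt0 ?exprn_gt0 // ltr_wpDr // mulr_ge0 ?exprn_ge0.
(* With [B = 264 * A ^+ 4] the polynomial factors are [B ^+ (3 * d)] for closing the walk and
   [B ^+ d] for the number of core points; the [2] keeps half of the main term. *)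
have [a0 Ha0] := poly_le_expR (2 * 264 ^+ (4 * d)) (4 * (4 * d)) c0.
exists (maxn 2 a0), (2 + c); split; [by rewrite leq_max|by rewrite addr_gt0|].
move=> a rho; rewrite geq_max => /andP[a2 aa0] /andP[r1 r2] x.
set n := (2 * rho)%N in x *; set m := (a ^ (4 * d + 3))%N.
have a_gt0 : (0 < a)%N := ltnW a2.
set A : R := a%:R.
have A1 : 1 <= A by rewrite ler1n.
have A0 : 0 < A by rewrite ltr0n.
have a41 : (1 < a ^ 4)%N by rewrite (leq_trans a2) // -{1}[a]expn1 leq_pexp2l.
set B : R := 264 * A ^+ 4.
have B1 : 1 <= B by rewrite /B; have := exprn_ege1 4 A1; lra.
have a40 : (0 < a ^ 4)%N := ltnW a41.
have [s1 s2 s3 s4] := box_scale a41 (introT andP (conj r1 r2)).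
have nB : 2 * n.+2%:R <= B by rewrite /B -natrX -!natrM ler_nat.
have nB' : n.+1%:R <= B.
  by apply: le_trans nB; rewrite -natrM ler_nat mul2n -addnn (leq_trans (leqnSn _)) // leq_addr.
have HB : 2 * B ^+ (4 * d) <= expR (c * A).
  by apply: le_trans (Ha0 a aa0); rewrite /B exprMn -exprM mulrA.
clearbody B.
have B0 : 0 < B := lt_le_trans ltr01 B1.
pose i0 : 'I_d := Ordinal (ltnW d2).
set w := (a ^ 2)%N.
have w0 : (0 < w)%N by rewrite expn_gt0 a_gt0.
have wa : (2 * w <= a ^ 4)%N.
  by rewrite /w (_ : 4 = 2 + 2)%N // expnD leq_mul // (leq_trans a2) // -{1}[a]expn1 leq_pexp2l.
have Lge : expR (- (A ^+ 4) ^- 2) <= cos (theta R n).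
  apply: cos_theta_ge; rewrite ?exprn_gt0 //.
    by rewrite -natrX -natrM ler_nat.
  by rewrite ler_nat.
have L0 : 0 < Lam R d n.
  by rewrite mulr_gt0 //; apply: lt_le_trans Lge; exact: expR_gt0.
have K1 v : v \in box_core n rho (a ^ 4) ->
    form_le_off (@box_adj d n) v (Lam R d n * expR (- gap_rate R d n w)).
  rewrite mem_filter => /andP[/forallP Hv _]; have Hi i := andP (Hv i).
  apply: (@box_form_le_off R d n w d2 w0 v i0).
  - move=> i; have [Hi1 Hi2] := Hi i; apply: (middle_near (q := (a ^ 4)%N) (w := w)) => //.
    by rewrite Hi1 /= (leq_ltn_trans Hi2) // -addnA ltn_add2l -{1}[(a ^ 4)%N]addn0 ltn_add2l.
  - move=> k /andP[Hk1 Hk2]; have [Hi1 Hi2] := Hi i0.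
    apply: (middle_near (q := (a ^ 4)%N) (w := w)) => //.
    by rewrite (leq_trans Hi1) //= (leq_trans Hk2) // leq_add2r.
  - have [_ Hi2] := Hi i0; rewrite (leq_trans (leq_add Hi2 (leqnn w))) //.
    by rewrite -addnA /n mul2n -addnn -addnS leq_add2l; apply: leqW; exact: core_fits r1.
have m0 : (0 < m)%N by rewrite expn_gt0 a_gt0.
apply: le_trans (covering_walks_ge (@box_adj_sym d n) x (mulr_gt0 L0 (expR_gt0 _))
  (@hbox_eigen R d n) (dot_hbox_gt0 n) K1 m0).
have LE : Lam R d n = (2 * d)%:R * cos (theta R n) by [].
move: (Lam R d n) L0 LE {K1} => L L0 LE; set M := (m + m)%N.
have t1 : L ^+ M * B ^- (3 * d) <= (L ^+ m * hbox R x) ^+ 2 / dot (@hbox R d n) (@hbox R d n).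
  rewrite ler_pdivlMr ?dot_hbox_gt0 // exprMn -exprM muln2 -addnn -/M -mulrA.
  rewrite ler_wpM2l ?exprn_ge0 ?(ltW L0) //.
  have hB : B ^- d <= hbox R x.
    apply: le_trans (hbox_ge R x); rewrite -exprVn.
    apply: lerXn2r; rewrite ?nnegrE ?invr_ge0 ?(ltW B0) ?mulr_ge0 //.
    by rewrite lef_pV2 ?posrE ?mulr_gt0.
  have Bd : 0 < B ^+ d by rewrite exprn_gt0.
  have Bi : 0 <= B ^- d by rewrite invr_ge0 ltW.
  apply: (@le_trans _ _ (B ^- d ^+ 2)); last by rewrite ler_pXn2r ?nnegrE // ltW ?hbox_gt0.
  have -> : B ^- (3 * d) = B ^- d ^+ 2 * B ^- d.
    by rewrite -exprSr -exprVn exprM exprAC -exprVn.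
  rewrite -mulrA ler_piMr ?exprn_ge0 // mulrC ler_pdivrMr // mul1r.
  apply: le_trans (dot_hbox_le n) _.
  by apply: lerXn2r; rewrite ?nnegrE ?(ltW B0).
have t2 : (size (box_core n rho (a ^ 4)))%:R * (L * expR (- gap_rate R d n w)) ^+ M
     <= L ^+ M * (B ^+ d * expR (- (c * A))).
  rewrite exprMn mulrCA ler_wpM2l ?exprn_ge0 ?(ltW L0) //.
  apply: ler_pM; rewrite ?exprn_ge0 ?expR_ge0 //.
    apply: (@le_trans _ _ (n.+1%:R ^+ d)).
      by rewrite -natrX ler_nat size_box_core.
    by apply: lerXn2r; rewrite ?nnegrE ?(ltW B0).
  rewrite -expRM_natl ler_expR mulrN lerN2 /M /m.
  exact: gap_rate_ge.
apply: le_trans (lerB t1 t2).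
rewrite -mulrBr.
have Bp k : 0 < B ^+ k by rewrite exprn_gt0.
have eB : expR (- (c * A)) <= 2^-1 * B ^- (4 * d).
  by rewrite expRN -invfM lef_pV2 ?posrE ?expR_gt0 ?mulr_gt0.
have B34 : B ^- (3 * d) = B ^+ d * B ^- (4 * d).
  have -> : (4 * d = d + 3 * d)%N by rewrite -mulSn.
  by rewrite exprD invfM mulrA divff ?mul1r ?gt_eqF.
have Bd1 : 1 <= B ^+ d by rewrite exprn_ege1.
(* At least half of the main term survives the union bound; it is bounded below crudely by
   [expR (- (c * A))]. *)
have main : expR (- (c * A)) <= B ^- (3 * d) - B ^+ d * expR (- (c * A)).
  rewrite B34 -mulrBr.
  have e0 := expR_gt0 (- (c * A)).
  set z := expR _ in eB e0 *; set Z := B ^- (4 * d) in eB *.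
  have : z <= Z - z by lra.
  nra.
apply: le_trans (ler_wpM2l _ main); last by rewrite exprn_ge0 ?(ltW L0).
rewrite LE exprMn mulrC -mulrA ler_wpM2l ?exprn_ge0 ?(ltW d0) //.
(* The [2] pays for [Lam] against [2 * d], the [c] for the crude factor, as
   [A <= A ^+ (4 * d - 5)]. *)
have -> : - ((2 + c) * A ^+ (4 * d - 5)) =
    M%:R * - (A ^+ 4) ^- 2 + - (c * A ^+ (4 * d - 5)).
  have -> : M%:R = 2 * A ^+ (4 * d - 5) * A ^+ 8.
    by rewrite /M /m natrD !natrX -mulrA -exprD E8; ring.
  rewrite -exprM; have A8 : A ^+ (4 * 2) != 0 by rewrite gt_eqF // exprn_gt0.
  by rewrite mulrN -(mulrA _ (A ^+ 8)) (divff A8); ring.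
rewrite expRD expRM_natl; apply: ler_pM; rewrite ?exprn_ge0 ?expR_ge0 //.
  by apply: lerXn2r; rewrite ?nnegrE ?expR_ge0 ?cos_theta_ge0.
by rewrite ler_expR lerN2 ler_wpM2l ?(ltW c0) // -{1}[A]expr1 ler_weXn2l.
Qed.

End BoxLoopCount.

(** * Families of lattice paths *)

Section BoxStay.
Variables (R : realType) (d : nat).

Lemma box_stay (n : nat) (q : R) (m : nat) (x : box d n) :
    4 * q <= n.+2%:R -> 0 < q -> 4 <= n.+2%:R :> R ->
  expR (- (m%:R * q ^- 2)) * (2 * n.+2%:R) ^- d * (2 * d)%:R ^+ m <=
    (size (walks (@box_adj d n) m x))%:R.
Proof.
move=> qn q0 n4.
have L0 : 0 <= Lam R d n by rewrite mulr_ge0 ?cos_theta_ge0.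
have := free_walks_ge m x (@hbox_le1 R d n) L0 (@hbox_eigen R d n).
apply: le_trans; rewrite mulrAC; apply: ler_pM; rewrite ?mulr_ge0 ?expR_ge0 ?exprn_ge0 ?invr_ge0 //.
- rewrite exprMn mulrC ler_wpM2l ?exprn_ge0 // -mulrN expRM_natl.
  by apply: lerXn2r; rewrite ?nnegrE ?expR_ge0 ?cos_theta_ge0 // cos_theta_ge.
- by rewrite -exprVn hbox_ge.
Qed.
End BoxStay.

Section Strategy.
Variables (R : realType) (d : nat).
Local Notation V := 'rV[int]_d.

Definition shift_box n (c : V) (x : box d n) : V := \row_i (c 0 i + (x i)%:Z).

Lemma shift_box_inj n c : injective (@shift_box n c).
Proof.
move=> x y /rowP E; apply/ffunP => i; have := E i; rewrite !mxE => /addrI [].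
exact: val_inj.
Qed.

Lemma shift_box_adj n c (x y : box d n) :
  box_adj x y -> Defs.adjacent (shift_box c x) (shift_box c y).
Proof.
move=> /existsP[i /andP[ci /forallP f]]; rewrite /Defs.adjacent (bigD1 i) //= !mxE.
rewrite big1 ?addr0 => [|j ji]; last first.
  have /implyP /(_ ji) /eqP E := f j.
  by rewrite !mxE E subrr normr0.
by move: ci; rewrite /consec; lia.
Qed.

Lemma adjacentC (x y : V) : Defs.adjacent x y = Defs.adjacent y x.
Proof. by congr (_ == _); apply: eq_bigr => i _; rewrite distrC. Qed.

Variable B : pred V.

(* A family of at least [exp (- kappa) * (2 d) ^ n] paths of [n] steps from [x]
   to [y] inside [B], each of which visits all of [U]; it has probability at
   least [exp (- kappa)] under the walk started from [x]. *)
Definition path_family (x y : V) (n : nat) (U : seq V) (kappa : R) : Prop :=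
  exists Ps : seq (seq V), [/\ uniq Ps,
    forall p, p \in Ps -> [/\ size p = n, path (@Defs.adjacent d) x p, last x p = y,
                              all B p & {subset U <= x :: p}] &
    expR (- kappa) * (2 * d)%:R ^+ n <= (size Ps)%:R].

Lemma path_family0 x : path_family x x 0 [:: x] 0.
Proof.
exists [:: [::]]; split => //=; last by rewrite oppr0 expR0 mul1r.
by move=> p; rewrite inE => /eqP ->; split.
Qed.

Lemma path_family_step x y : (0 < d)%N -> Defs.adjacent x y -> B y ->
  path_family x y 1 [:: x; y] (ln (2 * d)%:R).
Proof.
move=> d0 xy By; exists [:: [:: y]]; split => //=.
  move=> p; rewrite inE => /eqP -> /=; split => //; by rewrite ?xy ?By.
by rewrite expRN lnK ?posrE ?ltr0n ?muln_gt0 // expr1 mulVf // pnatr_eq0 muln_eq0 -lt0n d0.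
Qed.

Lemma path_family_weaken x y n U U' kappa kappa' :
    {subset U' <= U} -> kappa <= kappa' ->
  path_family x y n U kappa -> path_family x y n U' kappa'.
Proof.
move=> UU kk [Ps [uP HP cP]]; exists Ps; split=> // [p /HP[? ? ? ? sU]|].
  by split=> // u /UU /sU.
by apply: le_trans cP; rewrite ler_wpM2r ?exprn_ge0 // ler_expR lerN2.
Qed.

(** The lengths fix where a concatenation splits, so distinct pairs give distinct paths and the
    counts multiply. *)
Lemma path_family_cat x y z n n' U U' kappa kappa' :
    path_family x y n U kappa -> path_family y z n' U' kappa' ->
  path_family x z (n + n') (U ++ U') (kappa + kappa').
Proof.
move=> [Ps [uP HP cP]] [Qs [uQ HQ cQ]].
exists [seq p ++ q | p <- Ps, q <- Qs]; split.
- apply: allpairs_uniq => // -[p q] [p' q'] /allpairsP[[a b] /= [aP bQ [-> ->]]].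
  move=> /allpairsP[[a' b'] /= [aP' bQ' [-> ->]]] /= /eqP.
  have [s1 _ _ _ _] := HP _ aP; have [s2 _ _ _ _] := HP _ aP'.
  by rewrite eqseq_cat ?s1 ?s2 // => /andP[/eqP -> /eqP ->].
- move=> r /allpairsP[[p q] /= [pP qQ ->]].
  have [sp pp lp ap Up] := HP _ pP; have [sq pq lq aq Uq] := HQ _ qQ.
  split; rewrite ?size_cat ?sp ?sq //.
  + by rewrite cat_path pp lp pq.
  + by rewrite last_cat lp.
  + by rewrite all_cat ap aq.
  move=> u; rewrite mem_cat -cat_cons mem_cat => /orP[/Up ->//|/Uq].
  rewrite inE => /orP[/eqP ->|->]; last by rewrite orbT.
  by rewrite -lp mem_last.
rewrite size_allpairs [(size Ps * _)%:R]natrM opprD expRD exprD mulrACA.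
by apply: ler_pM; rewrite ?mulr_ge0 ?expR_ge0 ?exprn_ge0.
Qed.

Definition stay_family (x : V) (n : nat) (kappa : R) : Prop :=
  exists Ps : seq (seq V), [/\ uniq Ps,
    forall p, p \in Ps -> [/\ size p = n, path (@Defs.adjacent d) x p & all B p] &
    expR (- kappa) * (2 * d)%:R ^+ n <= (size Ps)%:R].

Lemma map_walks n c m (x : box d n) (p : seq (box d n)) :
    p \in walks (@box_adj d n) m x ->
    (forall y : box d n, B (shift_box c y)) ->
  [/\ size (map (shift_box c) p) = m,
      path (@Defs.adjacent d) (shift_box c x) (map (shift_box c) p),
      last (shift_box c x) (map (shift_box c) p) = shift_box c (last x p) &
      all B (map (shift_box c) p)].
Proof.
rewrite mem_walks => /andP[/eqP sp pp] HB; split.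
- by rewrite size_map.
- by rewrite path_map; apply: sub_path pp => y z; exact: shift_box_adj.
- by rewrite last_map.
- by apply/allP => _ /mapP[y _ ->].
Qed.

Lemma box_stay_family n c (x : box d n) (m : nat) (q : R) :
    (forall y : box d n, B (shift_box c y)) ->
    4 * q <= n.+2%:R -> 0 < q -> 4 <= n.+2%:R :> R ->
  stay_family (shift_box c x) m (m%:R * q ^- 2 + d%:R * ln (2 * n.+2%:R)).
Proof.
move=> HB qn q0 n4.
exists (map (map (shift_box c)) (walks (@box_adj d n) m x)); split.
- by rewrite map_inj_uniq ?uniq_walks //; apply/inj_map/shift_box_inj.
- by move=> _ /mapP[p /map_walks /(_ HB)[? ? _ ?] ->].
rewrite size_map; apply: le_trans (box_stay m x qn q0 n4).
rewrite ler_wpM2r ?exprn_ge0 // opprD expRD ler_wpM2l ?expR_ge0 //.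
by rewrite expRN expRM_natl lnK // posrE mulr_gt0.
Qed.

Lemma box_loop_family n c (x : box d n) (m : nat) (U : seq (box d n)) (kappa : R) :
    (forall y : box d n, B (shift_box c y)) ->
    expR (- kappa) * (2 * d)%:R ^+ m <=
      (count (fun p => (last x p == x) && all (fun v => v \in x :: p) U)
             (walks (@box_adj d n) m x))%:R ->
  path_family (shift_box c x) (shift_box c x) m (map (shift_box c) U) kappa.
Proof.
move=> HB; rewrite -size_filter => H.
set P := fun p => _ in H; exists (map (map (shift_box c)) [seq p <- walks (@box_adj d n) m x | P p]).
split; last by rewrite size_map.
  by rewrite map_inj_uniq ?filter_uniq ?uniq_walks //; apply/inj_map/shift_box_inj.
move=> _ /mapP[p + ->]; rewrite mem_filter => /andP[/andP[/eqP lp /allP Up]].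
move=> /map_walks /(_ HB)[? ? -> ?]; split=> //; first by rewrite lp.
by move=> _ /mapP[u /Up uU ->]; rewrite -map_cons map_f.
Qed.

End Strategy.

(** * Tours of connected sets and insertion of loops *)

Section Skeleton.
Variables (T : eqType) (e : rel T).
Hypothesis e_sym : symmetric e.

(** As in the tour of a spanning tree, each new vertex is reached by a detour of two steps from a
    vertex already visited. *)
Lemma tree_tour (S : seq T) (x0 : T) : x0 \in S ->
    (forall u, u \in S -> exists p, [/\ path e x0 p, all (mem S) p & last x0 p = u]) ->
  exists q, [/\ path e x0 q, all (mem S) q, {subset S <= x0 :: q} &
                (size q <= 2 * size S)%N].
Proof.
move=> x0S conn.
(* Invariant: at most two steps per distinct vertex visited so far. *)
pose ok q := [/\ path e x0 q, all (mem S) q & (size q <= 2 * size (undup (x0 :: q)))%N].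
have ins q w u : ok q -> w \in x0 :: q -> e w u -> u \in S -> u \notin x0 :: q ->
    exists q', [/\ ok q', {subset x0 :: q <= x0 :: q'} & u \in x0 :: q'].
  move=> [pq aq sq] wq wu uS uq; case/splitPl: wq pq aq sq uq => p1 p2 lw.
  rewrite cat_path lw all_cat => /andP[pp1 pp2] /andP[ap1 ap2] sq uq.
  (* The detour to [u] and back is spliced in after a visit to [w]. *)
  exists (p1 ++ [:: u, w & p2]).
  have M : x0 :: p1 ++ [:: u, w & p2] =i u :: x0 :: p1 ++ p2.
    move=> z; rewrite !inE !mem_cat !inE.
    have : z == w -> (z == x0) || (z \in p1).
      by move=> /eqP ->; rewrite -lw -in_cons mem_last.
    case: (z == w); case: (z == x0); case: (z \in p1); case: (z == u);
      case: (z \in p2) => //; by move=> /(_ isT).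
  split.
  - split.
    + by rewrite cat_path lw pp1 /= wu e_sym wu pp2.
    + rewrite all_cat ap1 /= uS ap2 andbT /=.
      move: (mem_last x0 p1); rewrite lw inE => /orP[/eqP ->//|wp1].
      exact: (allP ap1).
    + have sz (W W' : seq T) : u \notin W -> W' =i u :: W ->
          size (undup W') = (size (undup W)).+1.
        move=> uW WW; have -> : (size (undup W)).+1 = size (u :: undup W) by [].
        apply/perm_size/uniq_perm; rewrite ?undup_uniq ?cons_uniq ?mem_undup ?uW ?undup_uniq //.
        by move=> z; rewrite mem_undup WW !inE mem_undup.
      rewrite (sz _ _ uq M).
      by move: sq; rewrite !size_cat /= !addnS mulnS; lia.
  - by move=> z zq; rewrite M inE zq orbT.
  - by rewrite M inE eqxx.
have ext p q w : ok q -> w \in x0 :: q -> path e w p -> all (mem S) p ->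
    exists q', [/\ ok q', {subset x0 :: q <= x0 :: q'} & {subset p <= x0 :: q'}].
  elim: p q w => [|u p IH] q w okq wq /=.
    by move=> _ _; exists q; split=> // z.
  move=> /andP[wu pu] /andP[uS aS].
  have [q1 [ok1 s1 u1]] : exists q1,
      [/\ ok q1, {subset x0 :: q <= x0 :: q1} & u \in x0 :: q1].
    have [uq|uq] := boolP (u \in x0 :: q); first by exists q; split.
    exact: ins okq wq wu uS uq.
  have [q2 [ok2 s2 p2]] := IH q1 u ok1 u1 pu aS; exists q2; split=> //.
    by move=> z /s1 /s2.
  by move=> z; rewrite inE => /orP[/eqP ->|/p2 //]; apply: s2.
have all_L (L : seq T) : {subset L <= S} -> exists q, ok q /\ {subset L <= x0 :: q}.
  elim: L => [|u L IH] LS; first by exists [::].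
  have [|q [okq Lq]] := IH; first by move=> z zL; apply: LS; rewrite inE zL orbT.
  have [p [pp ap lp]] := conn u (LS u (mem_head _ _)).
  have [q' [ok' s' p']] := ext p q x0 okq (mem_head _ _) pp ap.
  exists q'; split=> // z; rewrite inE => /orP[/eqP ->|/Lq /s' //].
  rewrite -lp; case: p lp {pp ap} p' => [|y p] lp p'; first exact: mem_head.
  by apply: (p' (last y p)); exact: mem_last.
have [q [[pq aq sq] Sq]] := all_L S (fun z zS => zS).
exists q; split=> //; apply: leq_trans sq _; rewrite leq_mul2l; apply/orP; right.
apply: uniq_leq_size; first exact: undup_uniq.
move=> z; rewrite mem_undup inE => /orP[/eqP ->//|]; exact: (allP aq).
Qed.
End Skeleton.

Section LoopInsertion.
Variables (R : realType) (d : nat) (B : pred 'rV[int]_d).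
Variables (I : eqType) (b : I -> 'rV[int]_d) (len : I -> nat)
  (U : I -> seq 'rV[int]_d) (kappa : I -> R).
Hypothesis d0 : (0 < d)%N.

(** Each loop is run when the tour first passes its base point. A step of the tour is prescribed and
    costs [ln (2 * d)]. *)
Lemma path_family_loops (Zs : seq I) (x : 'rV[int]_d) (q : seq 'rV[int]_d) :
    (forall z, z \in Zs -> path_family B (b z) (b z) (len z) (U z) (kappa z)) ->
    path (@Defs.adjacent d) x q -> all B q ->
    (forall z, z \in Zs -> b z \in x :: q) ->
  path_family B x (last x q) (size q + \sum_(z <- Zs) len z)
    (flatten (map U Zs)) ((size q)%:R * ln (2 * d)%:R + \sum_(z <- Zs) kappa z).
Proof.
have base y Ys : (forall z, z \in Ys -> path_family B (b z) (b z) (len z) (U z) (kappa z)) ->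
    (forall z, z \in Ys -> b z = y) ->
    path_family B y y (\sum_(z <- Ys) len z) (flatten (map U Ys)) (\sum_(z <- Ys) kappa z).
  elim: Ys => [|z Ys IH] H by_.
    by rewrite !big_nil; apply: path_family_weaken (path_family0 _ _ _) => // ?.
  rewrite !big_cons; apply: path_family_cat (IH _ _).
  - by rewrite -(by_ z (mem_head _ _)); apply: H; exact: mem_head.
  - by move=> t tY; apply: H; rewrite inE tY orbT.
  - by move=> t tY; apply: by_; rewrite inE tY orbT.
elim: q x Zs => [|y q IH] x Zs H pq aq bq.
  rewrite /= add0n mul0r add0r; apply: base => // z /bq.
  by rewrite inE => /eqP.
move: pq aq => /= /andP[xy pq] /andP[By aq].
(* Loops based at [x] are run now; the others are based on the rest of the tour. *)
pose Z1 := [seq z <- Zs | b z == x]; pose Z2 := [seq z <- Zs | b z != x].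
have P1 := base x Z1.
have {P1} P1 : path_family B x x (\sum_(z <- Z1) len z) (flatten (map U Z1)) (\sum_(z <- Z1) kappa z).
  by apply: P1 => z; rewrite mem_filter => /andP[/eqP ? ?] //; exact: H.
have {IH} P2 : path_family B y (last y q) (size q + \sum_(z <- Z2) len z)
    (flatten (map U Z2)) ((size q)%:R * ln (2 * d)%:R + \sum_(z <- Z2) kappa z).
  apply: IH => // z; rewrite mem_filter => /andP[bz zZ]; first exact: H.
  by have := bq z zZ; rewrite inE (negbTE bz).
have := path_family_cat P1 (path_family_cat (path_family_step R d0 xy By) P2).
have E : \sum_(z <- Z1) kappa z + \sum_(z <- Z2) kappa z = \sum_(z <- Zs) kappa z.
  by rewrite !big_filter [RHS](bigID (fun z => b z == x)).
have -> : (\sum_(z <- Z1) len z + (1 + (size q + \sum_(z <- Z2) len z)) =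
   (size q).+1 + \sum_(z <- Zs) len z)%N.
  have El : (\sum_(z <- Z1) len z + \sum_(z <- Z2) len z = \sum_(z <- Zs) len z)%N.
    by rewrite !big_filter [RHS](bigID (fun z => b z == x)).
  by rewrite -El; lia.
apply: path_family_weaken.
  move=> u /flattenP[s /mapP[z zZ ->] us].
  rewrite !mem_cat; have [bz|bz] := boolP (b z == x).
    by apply/orP; left; apply/flattenP; exists (U z); rewrite ?map_f // mem_filter bz.
  apply/orP; right; apply/orP; right; apply/flattenP; exists (U z); rewrite ?map_f //.
  by rewrite mem_filter bz.
rewrite le_eqVlt; apply/orP; left; apply/eqP.
by rewrite -E -[(size (y :: q))%:R]natr1; ring.
Qed.
End LoopInsertion.

(** * Whitney cells *)

Section Geometry.
Variable d : nat.
Local Notation V := 'rV[int]_d.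
Implicit Types (x y z v w : V) (i j : 'I_d).

Definition supn x : nat := \max_i absz (x 0 i)%R.

Lemma supn_leP x r : reflect (forall i, (absz (x 0 i)%R <= r)%N) (supn x <= r)%N.
Proof.
by apply: (iffP (bigmax_leqP _ _ _)) => H i; [exact: H|move=> _; exact: H].
Qed.

Lemma le_supn x i : (absz (x 0 i)%R <= supn x)%N.
Proof. exact: (leq_bigmax (F := fun i => absz (x 0 i)%R)). Qed.

Lemma supn_eq x : (0 < d)%N -> exists i, absz (x 0 i)%R = supn x.
Proof.
move=> d0; have I0 : (0 < #|'I_d|)%N by rewrite card_ord.
have [i E] := @bigop.eq_bigmax _ (fun i => absz (x 0 i)%R) I0.
by exists i; rewrite /supn E.
Qed.

(** Lowest vertex of the cube of radius [r] about [z], which is then a shifted [box] of parameter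
    [2 * r]. *)
Definition corner z (r : nat) : V := \row_i (z 0 i - r%:Z).

Lemma supn_shift z r N (y : box d (2 * r)) :
  (supn z + r <= N)%N -> (supn (shift_box (corner z r) y) <= N)%N.
Proof.
move=> H; apply/supn_leP => i; rewrite !mxE.
by have := le_supn z i; have := ltn_ord (y i); lia.
Qed.

Lemma in_shift z r x : (forall i, (absz (x 0 i - z 0 i)%R <= r)%N) ->
  exists y : box d (2 * r), x = shift_box (corner z r) y.
Proof.
move=> H; exists [ffun i => inord (absz (x 0 i - z 0 i + r%:Z)%R)].
apply/rowP => i; rewrite !mxE ffunE inordK; have := H i; lia.
Qed.

Lemma in_shift_core z r q x : (q <= r)%N -> (forall i, (absz (x 0 i - z 0 i)%R <= q)%N) ->
  x \in map (shift_box (corner z r)) (box_core d (2 * r) r q).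
Proof.
move=> qr H; have [|y E] := @in_shift z r x; first by move=> i; exact: leq_trans (H i) qr.
apply/mapP; exists y => //; rewrite mem_filter mem_enum andbT.
by apply/forallP => i; have := H i; rewrite E !mxE; lia.
Qed.

Definition crust (N c : nat) : seq V :=
  [seq x <- map (shift_box (corner 0 N)) (enum {: box d (2 * N)}) | (N <= supn x + c)%N].

Lemma mem_crust N c x : (x \in crust N c) = (supn x <= N <= supn x + c)%N.
Proof.
rewrite mem_filter andbC; apply/andP/andP => -[H1 H2]; split=> //.
  by case/mapP: H1 => y _ ->; apply: supn_shift; rewrite [supn 0]big1 // => i _; rewrite mxE.
have [|y ->] := @in_shift 0 N x; last by rewrite map_f // mem_enum.
by move=> i; rewrite mxE subr0; move/supn_leP: H1; apply.
Qed.

(** Some coordinate is within [c] of an end of its range: [d] choices of it and [2 * c.+1] values;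
    the others are free. *)
Lemma size_crust N c : (0 < d)%N -> (size (crust N c) <= d * (2 * c.+1) * (2 * N).+1 ^ d.-1)%N.
Proof.
move=> d0; pose F i (y : box d (2 * N)) : bool := (y i <= c)%N || (2 * N <= y i + c)%N.
rewrite size_filter count_map.
have -> : count (preim (shift_box (corner 0 N)) (fun x => (N <= supn x + c)%N))
    (enum {: box d (2 * N)}) = #|[pred y : box d (2 * N) | (N <= supn (shift_box (corner 0 N) y) + c)%N]|.
  by rewrite -size_filter cardE enumT /enum_mem; congr size; apply: eq_filter.
apply: (@leq_trans (\sum_i #|F i|)).
  rewrite -sum1_card.
  apply: (@leq_trans (\sum_(y : box d (2 * N)) \sum_i (F i y : nat))).
    rewrite [leqRHS](bigID (fun y : box d (2 * N) => (N <= supn (shift_box (corner 0 N) y) + c)%N)) /=.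
    apply: leq_trans (leq_addr _ _); apply: leq_sum => y Hy.
    have [i Ei] := supn_eq (shift_box (corner 0 N) y) d0.
    rewrite (bigD1 i) //=; suff -> : F i y by [].
    by move: Hy; rewrite inE /= -Ei !mxE /F; have := ltn_ord (y i); lia.
  rewrite exchange_big; apply: leq_sum => i _ /=.
  by rewrite -sum1_card [leqRHS]big_mkcond; apply: leq_sum => y _; rewrite -[y \in F i]/(F i y); case: (F i y).
apply: (@leq_trans (\sum_(i < d) (2 * c.+1 * (2 * N).+1 ^ d.-1))); last first.
  by rewrite sum_nat_const card_ord mulnA.
apply: leq_sum => i _.
pose G j : pred 'I_(2 * N).+1 :=
  if j == i then [pred k : 'I__ | (k <= c)%N || (2 * N <= k + c)%N] else predT.
have -> : #|F i| = #|family G|.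
  apply: eq_card => y; rewrite unfold_in /F; apply/idP/familyP => [H j|/(_ i)].
    by rewrite /G; case: eqP => [->|].
  by rewrite /G eqxx.
rewrite card_family foldrE big_image /= (bigD1 i) //= leq_mul //; last first.
  rewrite (eq_bigr (fun=> (2 * N).+1)).
    by rewrite prod_nat_const cardC1 card_ord.
  by move=> j /negbTE ji; rewrite /G ji card_ord.
rewrite /G eqxx.
apply: (@leq_trans (#|[pred k : 'I_(2 * N).+1 | (k <= c)%N]| +
                    #|[pred k : 'I_(2 * N).+1 | (2 * N <= k + c)%N]|)).
  rewrite -[X in (_ <= X)%N]cardUI; apply: leq_trans (leq_addr _ _).
  by apply/subset_leq_card/fintype.subsetP => k; rewrite !inE.
have le_card (P : pred 'I_(2 * N).+1) (f : 'I_(2 * N).+1 -> nat) :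
    {in P &, injective f} -> (forall k, P k -> (f k <= c)%N) -> (#|P| <= c.+1)%N.
  move=> fi fc; rewrite -[c.+1]card_ord.
  rewrite -(@card_in_image _ _ (fun k => inord (f k) : 'I_c.+1) P); first exact: max_card.
  move=> k l kP lP /(congr1 val) /=.
  by rewrite !inordK ?ltnS ?fc //; exact: fi.
rewrite [(2 * c.+1)%N]mul2n -addnn; apply: leq_add.
  by apply: (@le_card _ val) => // k l _ _; exact: val_inj.
apply: (@le_card _ (fun k => 2 * N - k)%N) => [k l _ _ E|k] /=; last first.
  by have := ltn_ord k; lia.
by apply/val_inj => /=; have := ltn_ord k; have := ltn_ord l; lia.
Qed.

End Geometry.

(** * The surface of a cube and a tour of it *)

Section ShellConnected.
Variable d : nat.
Local Notation V := 'rV[int]_d.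
Implicit Types (x y z v w : V) (i j : 'I_d) (S : pred V).

Definition setc x i (a : int) : V := \row_j (if j == i then a else x 0 j).

Lemma setc_id x i : setc x i (x 0 i) = x.
Proof. by apply/rowP => j; rewrite mxE; case: eqP => [->|]. Qed.

Lemma setcE x i a : setc x i a 0 i = a.
Proof. by rewrite mxE eqxx. Qed.

Lemma setc_neq x i j a : j != i -> setc x i a 0 j = x 0 j.
Proof. by rewrite mxE => /negbTE ->. Qed.

Lemma adj_setc x i a b : `|a - b| = 1 -> Defs.adjacent (setc x i a) (setc x i b).
Proof.
move=> ab; rewrite /Defs.adjacent (bigD1 i) //= !setcE ab big1 ?addr0 // => j ji.
by rewrite !setc_neq // subrr normr0.
Qed.

(** Only the sites after the start must lie in [S], hence the extra hypothesis of [conn_sym]. *)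
Definition conn S x y : Prop :=
  exists p, [/\ path (@Defs.adjacent d) x p, all S p & last x p = y].

Lemma conn_refl S x : conn S x x.
Proof. by exists [::]. Qed.

Lemma conn_trans S x y z : conn S x y -> conn S y z -> conn S x z.
Proof.
move=> [p [pp ap lp]] [q [pq aq lq]]; exists (p ++ q).
by rewrite cat_path pp lp pq all_cat ap aq last_cat lp lq.
Qed.

Lemma conn_sym S x y : S x -> conn S x y -> conn S y x.
Proof.
move=> Sx [p [pp ap lp]]; exists (rev (belast x p)); split.
- by rewrite -lp rev_path; apply: sub_path pp => u v; rewrite adjacentC.
- rewrite all_rev; apply/allP => u /mem_belast; rewrite inE => /orP[/eqP -> //|].
  exact: (allP ap).
- by case: p {pp ap} lp => //= u p _; rewrite rev_cons last_rcons.
Qed.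

Lemma conn_line S x i (s : int) n : `|s| = 1 ->
    (forall k, (k <= n)%N -> S (setc x i (x 0 i + s * k%:Z))) ->
  conn S x (setc x i (x 0 i + s * n%:Z)).
Proof.
move=> s1; elim: n => [|n IH] H; first by rewrite mulr0 addr0 setc_id; exact: conn_refl.
apply: conn_trans (IH _) _; first by move=> k kn; apply: H; exact: leqW.
exists [:: setc x i (x 0 i + s * n.+1%:Z)]; split=> //=; rewrite andbT; last exact: H.
apply: adj_setc; rewrite intS.
by rewrite (_ : _ - _ = - s) ?normrN //; ring.
Qed.

Lemma conn_move S x i (a : int) :
    (forall b, (x 0 i <= b <= a) || (a <= b <= x 0 i) -> S (setc x i b)) ->
  conn S x (setc x i a).
Proof.
move=> H; pose s : int := if x 0 i <= a then 1 else -1.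
have -> : a = x 0 i + s * (absz (a - x 0 i)%R)%:Z by rewrite /s; case: ifP; lia.
apply: conn_line; first by rewrite /s; case: ifP.
by move=> k kn; apply: H; move: kn; rewrite /s; case: ifP; lia.
Qed.

Variables (N : nat).

Definition shell : pred V := fun x => supn x == N.

Lemma supn_setc x i a : (supn x <= N)%N -> (absz a <= N)%N -> (supn (setc x i a) <= N)%N.
Proof.
move=> /supn_leP xN aN; apply/supn_leP => j; rewrite mxE; case: eqP => // _; exact: xN.
Qed.

Lemma shellP x i : (supn x <= N)%N -> absz (x 0 i)%R = N -> shell x.
Proof. by move=> xN xi; rewrite /shell eqn_leq xN -{1}xi le_supn. Qed.

(** A coordinate of absolute value [N] keeps the point on the shell while all others move to [N];
    then one of these takes over that role while the first one moves. *)
Lemma shell_conn x : (1 < d)%N -> shell x -> conn shell x (const_mx N%:Z).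
Proof.
move=> d2 Sx; have [i xi] := supn_eq x (ltnW d2); rewrite (eqP Sx) in xi.
have xN : (supn x <= N)%N by rewrite (eqP Sx).
have fill (L : seq 'I_d) : i \notin L -> exists y,
    [/\ conn shell x y, (supn y <= N)%N, y 0 i = x 0 i & forall j, j \in L -> y 0 j = N%:Z].
  elim: L => [|j L IH]; first by exists x; split=> //; exact: conn_refl.
  rewrite inE negb_or => /andP[ij iL].
  have [y [cy yN yi yL]] := IH iL; exists (setc y j N%:Z); split.
  - apply: conn_trans cy _; apply: conn_move => b Hb.
    apply: (@shellP _ i); last by rewrite setc_neq // yi.
    by apply: supn_setc => //; have := le_supn y j; move: Hb; lia.
  - exact: supn_setc.
  - by rewrite setc_neq.
  - move=> k; rewrite inE; have [->|kj] := eqVneq k j; first by rewrite setcE.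
    by move=> kL; rewrite setc_neq //; exact: yL.
have [|y [cy yN yi yL]] := fill [seq j <- enum 'I_d | j != i].
  by rewrite mem_filter eqxx.
have yj j : j != i -> y 0 j = N%:Z by move=> ji; apply: yL; rewrite mem_filter ji mem_enum.
have [j ji] : exists j : 'I_d, j != i.
  have [i0|i0] := eqVneq (i : nat) 0%N.
    by exists (Ordinal d2); apply/eqP => /(congr1 val) /=; rewrite i0.
  by exists (Ordinal (ltnW d2)); apply/eqP => /(congr1 val) /= E; rewrite -E in i0.
have -> : const_mx N%:Z = setc y i N%:Z :> V.
  by apply/rowP => k; rewrite !mxE; case: eqP => // /eqP /yj ->.
apply: conn_trans cy _; apply: conn_move => b Hb.
apply: (@shellP _ j); last by rewrite setc_neq // yj.
by apply: supn_setc => //; have := le_supn y i; move: Hb; lia.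
Qed.

Variable i0 : 'I_d.

Definition axis_point (k : nat) : V := setc 0 i0 k%:Z.

(* The axis segment joins the starting point of the walk to the boundary of the cube. *)
Definition skeleton : seq V := map axis_point (iota 0 N.+1) ++ crust d N 0.

Lemma mem_skeleton x : shell x -> x \in skeleton.
Proof. by move=> /eqP xN; rewrite mem_cat mem_crust xN addn0 leqnn orbT. Qed.

Lemma supn_axis k : supn (axis_point k) = k.
Proof.
apply/eqP; rewrite eqn_leq; apply/andP; split.
  apply/supn_leP => j; rewrite mxE; case: eqP => // _; by rewrite mxE.
by have := le_supn (axis_point k) i0; rewrite setcE.
Qed.

Lemma skeleton_supn x : x \in skeleton -> (supn x <= N)%N.
Proof.
rewrite mem_cat => /orP[/mapP[k]|].
  by rewrite mem_iota add0n ltnS => kN ->; rewrite supn_axis.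
by rewrite mem_crust => /andP[].
Qed.

Lemma size_skeleton : (size skeleton <= N.+1 + d * 2 * (2 * N).+1 ^ d.-1)%N.
Proof.
rewrite size_cat size_map size_iota leq_add2l.
by apply: leq_trans (size_crust _ _ (leq_ltn_trans (leq0n _) (ltn_ord i0))) _.
Qed.

Lemma axis_skeleton k : (k <= N)%N -> axis_point k \in skeleton.
Proof. by move=> kN; rewrite mem_cat map_f // mem_iota add0n ltnS. Qed.

Lemma skeleton_conn x : (1 < d)%N -> x \in skeleton -> conn (mem skeleton) 0 x.
Proof.
move=> d2; have ax k : (k <= N)%N -> conn (mem skeleton) 0 (axis_point k).
  move=> kN; apply: conn_move => b; rewrite mxE => Hb.
  have -> : b = (absz b)%:Z by lia.
  by apply: axis_skeleton; lia.
have mono y z : conn shell y z -> conn (mem skeleton) y z.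
  move=> [p [pp ap lp]]; exists p; split=> //.
  by apply: sub_all ap => u; exact: mem_skeleton.
rewrite mem_cat => /orP[/mapP[k]|].
  by rewrite mem_iota add0n ltnS => kN ->; exact: ax.
rewrite mem_crust addn0 -eqn_leq => xN.
have aN : shell (axis_point N) by rewrite /shell supn_axis.
apply: conn_trans (ax N (leqnn N)) _; apply: mono.
apply: conn_trans (shell_conn d2 aN) _; apply: conn_sym; first exact: xN.
exact: shell_conn.
Qed.

Lemma skeleton_tour : (1 < d)%N -> exists q,
  [/\ path (@Defs.adjacent d) 0 q, all (fun x => (supn x <= N)%N) q,
      (forall x, supn x = N -> x \in 0 :: q) &
      (size q <= 2 * (N.+1 + d * 2 * (2 * N).+1 ^ d.-1))%N].
Proof.
move=> d2; have z0 : (0 : V) \in skeleton.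
  have -> : (0 : V) = axis_point 0 by apply/rowP => j; rewrite !mxE; case: eqP.
  exact: axis_skeleton.
have [q [pq aq sq lq]] := tree_tour (@adjacentC d) z0 (fun u => skeleton_conn d2).
exists q; split=> //.
- by apply: sub_all aq => x; exact: skeleton_supn.
- by move=> x /eqP xN; apply: sq; exact: mem_skeleton.
- by apply: leq_trans lq _; rewrite leq_mul2l /= size_skeleton.
Qed.

End ShellConnected.

(** * Whitney decomposition of the cube *)

Section Whitney.
Variable d : nat.
Hypothesis d2 : (1 < d)%N.
Local Notation V := 'rV[int]_d.
Implicit Types (x y z v w : V) (i j : 'I_d).

Let d0 : (0 < d)%N := ltnW d2.

(** A largest coordinate is pushed outwards to absolute value [N]. The resulting point will be the
    base of a loop. *)
Lemma boundary_point N z : (supn z <= N)%N ->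
  exists u, supn u = N /\ forall i, (absz (u 0 i - z 0 i)%R <= N - supn z)%N.
Proof.
move=> zN; have [i zi] := supn_eq z d0.
pose a : int := if 0 <= z 0 i then N%:Z else - N%:Z.
have aN : absz a = N by rewrite /a; case: ifP; lia.
exists (setc z i a); split.
  apply/eqP; rewrite -[_ == _]/(shell N (setc z i a)); apply: (@shellP _ _ _ i); last by rewrite setcE.
  by apply: supn_setc; rewrite ?aN.
move=> j; rewrite mxE; case: eqP => [->|_]; last by rewrite subrr.
by have := le_supn z i; rewrite /a -zi; case: ifP; lia.
Qed.

(* [cell_center (l, w)] runs over the points of the grid [16 ^ l * Z ^ d] whose
   distance to the complement of the cube of radius [16 ^ J] is of order [16 ^ l]. *)
Definition cell_center (c : nat * V) : V := \row_i ((16 ^ c.1)%:Z * c.2 0 i).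

(** Distance from the cell centre to the surface of the big cube: the cube of this radius about the
    centre just touches a face. *)
Definition cell_radius (J : nat) (c : nat * V) : nat :=
  (16 ^ c.1 * (16 ^ (J - c.1) - supn c.2))%N.

(** Grid points whose distance to the surface is between [3] and [65] grid spacings [16 ^ l]. *)
Definition cell_level (J l : nat) : seq V :=
  [seq w <- crust d (16 ^ (J - l)) 65 | (supn w + 3 <= 16 ^ (J - l))%N].

Definition cells (m J : nat) : seq (nat * V) :=
  [seq (l, w) | l <- iota m (J - m), w <- cell_level J l].

Lemma mem_cells m J l w : (l, w) \in cells m J ->
  [/\ (m <= l < J)%N, (supn w + 3 <= 16 ^ (J - l))%N & (16 ^ (J - l) <= supn w + 65)%N].
Proof.
move=> /allpairsPdep[l' [w' [+ + [-> ->]]]]; rewrite mem_iota mem_filter mem_crust //.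
by move=> /andP[ml lJ] /and3P[H1 H2 H3]; rewrite H1 H3 ml; split=> //; lia.
Qed.

Lemma supn_cell_center c : supn (cell_center c) = (16 ^ c.1 * supn c.2)%N.
Proof.
apply/eqP; rewrite eqn_leq; apply/andP; split.
  by apply/supn_leP => i; rewrite mxE abszM absz_nat leq_mul2l le_supn orbT.
have [i <-] := supn_eq c.2 d0.
by have := le_supn (cell_center c) i; rewrite mxE abszM absz_nat.
Qed.

Lemma cell_radiusE m J c : c \in cells m J ->
  (supn (cell_center c) + cell_radius J c = 16 ^ J)%N.
Proof.
case: c => l w /mem_cells[/andP[_ lJ] H _]; rewrite supn_cell_center /cell_radius /= -mulnDr.
rewrite subnKC; last exact: leq_trans (leq_addr _ _) H.
by rewrite -expnD subnKC // ltnW.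
Qed.

Lemma cell_radius_bounds m J c : c \in cells m J ->
  (3 * 16 ^ c.1 <= cell_radius J c <= 65 * 16 ^ c.1)%N.
Proof.
case: c => l w /mem_cells[_ H1 H2]; rewrite /cell_radius /= [(3 * _)%N]mulnC [(65 * _)%N]mulnC.
by rewrite !leq_mul2l; apply/andP; split; apply/orP; right; lia.
Qed.

Lemma floor_close (q : nat) (a : int) : (0 < q)%N ->
  (absz (a - q%:Z * (a %/ q)%Z)%R <= q)%N.
Proof.
move=> q0; have q1 : (q : int) != 0 by lia.
have -> : a - q%:Z * (a %/ q)%Z = (a %% q)%Z by rewrite {1}(divz_eq a q); ring.
have := modz_ge0 a q1; have := ltz_mod a q1; lia.
Qed.

(** With [k] the distance from [v] to the surface, [l] is chosen so that
    [4 * 16 ^ l <= k < 64 * 16 ^ l]. Rounding [v] down to the grid changes the distance by at most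
    one spacing, whence the bounds [3] and [65]. *)
Lemma cells_cover m J v : (supn v + 4 * 16 ^ m <= 16 ^ J)%N ->
  exists2 c, c \in cells m J & forall i, (absz (v 0 i - cell_center c 0 i)%R <= 16 ^ c.1)%N.
Proof.
move=> H; pose k := (16 ^ J - supn v)%N.
have k4 : (0 < k %/ 4)%N by rewrite divn_gt0 // (leq_trans _ (leq_sub2r (supn v) H)) // addKn leq_pmulr // expn_gt0.
pose l := trunc_log 16 (k %/ 4).
have lk : (4 * 16 ^ l <= k)%N by rewrite mulnC -leq_divRL // trunc_logP.
have kl : (k < 4 * 16 ^ l.+1)%N by rewrite mulnC -ltn_divLR // trunc_log_ltn.
have ml : (m <= l)%N.
  rewrite -ltnS -(ltn_exp2l _ _ (isT : 1 < 16)%N) -(ltn_pmul2l (isT : 0 < 4)%N).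
  by apply: leq_ltn_trans kl; rewrite /k; lia.
have lJ : (l < J)%N.
  rewrite -(ltn_exp2l _ _ (isT : 1 < 16)%N).
  have : (0 < 16 ^ l)%N by rewrite expn_gt0.
  by move: lk; rewrite /k; lia.
have q0 : (0 < 16 ^ l)%N by rewrite expn_gt0.
have EJ : (16 ^ J = 16 ^ l * 16 ^ (J - l))%N by rewrite -expnD subnKC // ltnW.
rewrite expnS in kl; rewrite /k EJ in lk kl.
set q := (16 ^ l)%N in q0 lk kl EJ *; set M := (16 ^ (J - l))%N in lk kl EJ *.
pose w : V := \row_i (v 0%R i %/ q)%Z.
have cl i : (absz (v 0 i - q%:Z * w 0 i)%R <= q)%N by rewrite mxE; exact: floor_close.
have up : (q * supn w <= supn v + q)%N.
  have [i <-] := supn_eq w d0; have := cl i; have := le_supn v i.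
  by rewrite -[q in (q * _)%N]absz_nat -abszM; lia.
have dn : (supn v <= q * supn w + q)%N.
  have [i <-] := supn_eq v d0; have := cl i.
  have : (q * absz (w 0 i)%R <= q * supn w)%N by rewrite leq_mul2l le_supn orbT.
  by rewrite -[q in (q * absz _)%N]absz_nat -abszM; lia.
exists (l, w); last by move=> i; rewrite mxE /= -/q.
apply/allpairsPdep; exists l, w; split=> //; first by rewrite mem_iota ml subnKC ?(ltnW lJ) ?(leq_trans ml (ltnW lJ)).
have w3 : (supn w + 3 <= M)%N.
  rewrite -(leq_pmul2l q0) mulnDr; lia.
rewrite mem_filter mem_crust // -/M w3 /=; apply/andP; split; first lia.
rewrite -(leq_pmul2l q0) mulnDr; lia.
Qed.

(** Here [132 = 2 * (65 + 1)], and [2 * N + 1 <= 3 * N] for [N = 16 ^ (J - l)]. *)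
Lemma size_cell_level J l : (l <= J)%N ->
  (size (cell_level J l) <= d * 132 * 3 ^ d.-1 * (16 ^ (J - l)) ^ d.-1)%N.
Proof.
move=> lJ; rewrite size_filter (leq_trans (count_size _ _)) //.
apply: leq_trans (size_crust _ _ d0) _.
rewrite -[leqRHS]mulnA -expnMn; apply: leq_mul => //.
rewrite leq_exp2r; last by rewrite -ltnS prednK.
have : (0 < 16 ^ (J - l))%N by rewrite expn_gt0.
lia.
Qed.
End Whitney.

(** * Summation over scales and the strategy of the walk *)

Section CoverStrategy.
Variables (R : realType) (d : nat).
Hypothesis d2 : (1 < d)%N.
Local Notation V := 'rV[int]_d.

Lemma sum_geometric (m n : nat) : (\sum_(l <- iota m n) 128 ^ l <= 128 ^ (m + n))%N.
Proof.
have H : (127 * \sum_(l <- iota m n) 128 ^ l + 128 ^ m = 128 ^ (m + n))%N.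
  elim: n m => [|n IH] m; first by rewrite big_nil addn0.
  by rewrite /= big_cons addnS -addSn -IH expnS; lia.
by rewrite -H; lia.
Qed.

Lemma sum_half (m n : nat) : \sum_(l <- iota m n) 2^-1 ^+ l <= 2 :> R.
Proof.
have H : \sum_(l <- iota m n) 2^-1 ^+ l + 2 * 2^-1 ^+ (m + n) = 2 * 2^-1 ^+ m :> R.
  elim: n m => [|n IH] m; first by rewrite big_nil add0r addn0.
  by rewrite /= big_cons addnS -addSn -addrA IH exprS; field.
have h0 k : 0 <= 2^-1 ^+ k :> R by rewrite exprn_ge0 // invr_ge0.
have h1 : 2^-1 ^+ m <= 1 :> R by apply: exprn_ile1; lra.
have := h0 (m + n)%N; lra.
Qed.

Lemma cells_sum (F : nat * V -> R) m J :
  \sum_(c <- cells d m J) F c =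
  \sum_(l <- iota m (J - m)) \sum_(w <- cell_level d J l) F (l, w).
Proof. by rewrite big_allpairs_dep. Qed.

Definition crust_const : nat := (d * 132 * 3 ^ d.-1)%N.

(** Let [a = 2 ^ l] and [A = 2 ^ J]. Level [l] has [O((A / a) ^ (4 * (d - 1)))] cells, of total cost
    [O(A ^ (4 * (d - 1)) / a)] and total length [O(A ^ (4 * (d - 1)) * a ^ 7)]. *)
Lemma cell_scaling J l : (l <= J)%N ->
  ((16 ^ (J - l)) ^ d.-1 * (2 ^ l) ^ (4 * d - 5) * 2 ^ l = (2 ^ J) ^ (4 * d.-1))%N /\
  ((16 ^ (J - l)) ^ d.-1 * (2 ^ l) ^ (4 * d + 3) = (2 ^ J) ^ (4 * d.-1) * 128 ^ l)%N.
Proof.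
move=> lJ; have -> : J = (J - l + l)%N by rewrite subnK.
set p := (J - l)%N; rewrite addnK.
have -> : (16 = 2 ^ 4)%N by []. have -> : (128 = 2 ^ 7)%N by [].
rewrite -!expnM -!expnD; split; congr expn; case: d d2 => [|[|k]] // _ /=; last nia.
have -> : (4 * k.+2 - 5 = 4 * k + 3)%N by lia.
nia.
Qed.

Lemma cells_cost (C : R) m J : 0 <= C -> (m <= J)%N ->
  \sum_(c <- cells d m J) C * (2 ^ c.1)%:R ^+ (4 * d - 5) <=
    2 * C * crust_const%:R * (2 ^ J)%:R ^+ (4 * d.-1).
Proof.
move=> C0 mJ; rewrite cells_sum.
apply: (@le_trans _ _ (\sum_(l <- iota m (J - m))
    (C * crust_const%:R * (2 ^ J)%:R ^+ (4 * d.-1) * 2^-1 ^+ l))); last first.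
  rewrite -mulr_sumr; have := sum_half m (J - m) => H.
  have P : 0 <= C * crust_const%:R * (2 ^ J)%:R ^+ (4 * d.-1) by rewrite !mulr_ge0 ?exprn_ge0.
  have := ler_wpM2l P H; lra.
rewrite big_seq [leRHS]big_seq; apply: ler_sum => l; rewrite mem_iota subnKC // => /andP[_ lJ].
rewrite /= big_const_seq iter_addr_0 count_predT -[_ *+ _]mulr_natl /=.
have [E1 _] := cell_scaling (ltnW lJ).
set X := ((16 ^ (J - l)) ^ d.-1)%N in E1; set Y : R := (2 ^ l)%:R ^+ (4 * d - 5).
have -> : (2 ^ J)%:R ^+ (4 * d.-1) = X%:R * Y * 2 ^+ l :> R.
  by rewrite /Y -!natrX -!natrM E1.
have -> : C * crust_const%:R * (X%:R * Y * 2 ^+ l) * 2^-1 ^+ l =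
    crust_const%:R * X%:R * (C * Y) :> R.
  have H : 2 ^+ l * 2^-1 ^+ l = 1 :> R by rewrite -exprMn divff // expr1n.
  by rewrite -!mulrA H mulr1; ring.
rewrite ler_wpM2r ?mulr_ge0 ?exprn_ge0 // -natrM ler_nat.
by apply: size_cell_level => //; exact: ltnW.
Qed.

(** The length is dominated by the largest cells, whereas the cost bound is dominated by the
    smallest; [128 = 2 ^ 7]. *)
Lemma cells_length m J : (m <= J)%N ->
  (\sum_(c <- cells d m J) ((2 ^ c.1) ^ (4 * d + 3) + (2 ^ c.1) ^ (4 * d + 3)) <=
    2 * crust_const * (2 ^ J) ^ (4 * d + 3))%N.
Proof.
move=> mJ; rewrite big_allpairs_dep /=.
apply: (@leq_trans (\sum_(l <- iota m (J - m))
    (2 * crust_const * (2 ^ J) ^ (4 * d.-1) * 128 ^ l))%N); last first.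
  rewrite -big_distrr /= -[leqLHS]mulnA; apply: leq_mul => //.
  apply: (@leq_trans ((2 ^ J) ^ (4 * d.-1) * 128 ^ J)%N).
    by have := sum_geometric m (J - m); rewrite subnKC // => H; rewrite leq_mul2l H orbT.
  have -> : (4 * d + 3 = 4 * d.-1 + 7)%N by case: d d2 => // k _ /=; lia.
  by rewrite expnD leq_mul // (_ : 128 = 2 ^ 7)%N // -!expnM mulnC.
rewrite big_seq [leqRHS]big_seq; apply: leq_sum => l; rewrite mem_iota subnKC // => /andP[_ lJ].
rewrite /= big_const_seq iter_addn_0 count_predT.
have [_ E2] := cell_scaling (ltnW lJ).
have := size_cell_level d2 (ltnW lJ); rewrite -/crust_const -mulnA -E2.
set X := ((16 ^ (J - l)) ^ d.-1)%N; set Y := ((2 ^ l) ^ (4 * d + 3))%N => H.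
apply: (@leq_trans ((Y + Y) * (crust_const * X))%N); first by rewrite leq_mul2l H orbT.
by apply: eq_leq; ring.
Qed.

End CoverStrategy.

Section CoverPaths.
Variables (R : realType) (d : nat).
Hypothesis d2 : (1 < d)%N.
Local Notation V := 'rV[int]_d.

Definition cube (N : nat) : pred V := fun x => (supn x <= N)%N.

(** The length of the skeleton tour is of surface order [N ^ (d - 1)] with [N = 16 ^ J]; this
    includes the axis segment because [d >= 2]. *)
Lemma cube_volume_bound (J : nat) :
  (2 * ((16 ^ J).+1 + d * 2 * (2 * 16 ^ J).+1 ^ d.-1) <=
   4 * (1 + d * 3 ^ d.-1) * (2 ^ J) ^ (4 * d.-1))%N.
Proof.
have -> : ((2 ^ J) ^ (4 * d.-1) = (16 ^ J) ^ d.-1)%N.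
  by rewrite (_ : 16 = 2 ^ 4)%N // -!expnM; congr expn; rewrite mulnCA.
have : (0 < 16 ^ J)%N by rewrite expn_gt0.
move: (16 ^ J)%N => N N0.
have d1 : (0 < d.-1)%N by rewrite -ltnS prednK // ltnW.
have H1 : (N <= N ^ d.-1)%N by rewrite -{1}[N]expn1 leq_pexp2l.
have H2 : ((2 * N).+1 ^ d.-1 <= 3 ^ d.-1 * N ^ d.-1)%N.
  by rewrite -expnMn leq_exp2r //; lia.
move: H1 H2; move: (N ^ d.-1)%N ((2 * N).+1 ^ d.-1)%N (3 ^ d.-1)%N => X Y Z H1 H2.
have H3 : (d * Y <= d * (Z * X))%N by rewrite leq_mul2l H2 orbT.
nia.
Qed.

(** The tour of the skeleton with one covering loop per Whitney cell, based at a point where the box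
    of the cell meets the surface. *)
Lemma cover_strategy : exists (m : nat) (C : R), 0 < C /\
  forall J : nat, (m <= J)%N -> exists (n : nat) (y : V) (U : seq V),
    [/\ n%:R <= C * (2 ^ J)%:R ^+ (4 * d + 3), cube (16 ^ J) y,
        path_family (cube (16 ^ J)) 0 y n U (C * (2 ^ J)%:R ^+ (4 * d.-1)) &
        forall v, (supn v + 4 * 16 ^ m <= 16 ^ J)%N -> v \in U].
Proof.
(* The threshold on [a] also serves as the first level [m], since [a = 2 ^ l > l >= m]. *)
have [m [C1 [m1 C10 loops]]] := box_loops R d2.
pose L0 : R := ln (2 * d)%:R.
have L00 : 0 <= L0 by rewrite ln_ge0 // ler1n muln_gt0 /= ltnW.
pose Cq : R := (4 * (1 + d * 3 ^ d.-1))%:R.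
have Cq1 : 1 <= Cq by rewrite ler1n muln_gt0.
pose C := Cq + (2 * crust_const d)%:R + Cq * L0 + 2 * C1 * (crust_const d)%:R.
have C0 : 0 < C by rewrite !ltr_wpDr ?mulr_ge0 ?(ltW C10) // (lt_le_trans ltr01).
exists m, C; split=> // J mJ; set N := (16 ^ J)%N; set A : R := (2 ^ J)%:R.
have A1 : 1 <= A by rewrite ler1n expn_gt0.
have [q [pq aq sq lq]] := skeleton_tour N (Ordinal (ltnW d2)) d2.
pose P (c : nat * V) u := supn u = N /\
  forall i, (absz (u 0 i - cell_center c 0 i)%R <= cell_radius J c)%N.
have bex c : exists u, c \in cells d m J -> P c u.
  have [cm|cm] := boolP (c \in cells d m J); last by exists 0.
  have H := cell_radiusE d2 cm.
  have [|u [uN Hu]] := @boundary_point d d2 N (cell_center c).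
    by rewrite /N -H leq_addr.
  exists u => _; split=> // i; apply: leq_trans (Hu i) _.
  by rewrite /N -H addKn.
have [b Pb] := boolp.choice bex.
pose len (c : nat * V) := ((2 ^ c.1) ^ (4 * d + 3) + (2 ^ c.1) ^ (4 * d + 3))%N.
pose kap (c : nat * V) : R := C1 * (2 ^ c.1)%:R ^+ (4 * d - 5).
pose U (c : nat * V) := map (shift_box (corner (cell_center c) (cell_radius J c)))
  (box_core d (2 * cell_radius J c) (cell_radius J c) (16 ^ c.1)).
have q16 (c : nat * V) : ((2 ^ c.1) ^ 4 = 16 ^ c.1)%N.
  by rewrite (_ : 16 = 2 ^ 4)%N // -!expnM mulnC.
have loop c : c \in cells d m J ->
    path_family (cube N) (b c) (b c) (len c) (U c) (kap c).
  move=> cm; have mc : (m <= c.1)%N.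
    by move: (cm); case: (c) => l w /(mem_cells d2) [/andP[]].
  have [_ bz] := Pb c cm; have [x ->] := in_shift bz.
  apply: box_loop_family.
    by move=> y; apply: supn_shift; rewrite (cell_radiusE d2 cm).
  have := loops (2 ^ c.1)%N (cell_radius J c) _ _ x; rewrite q16; apply.
    by apply: leq_trans mc _; apply: ltnW; exact: ltn_expl.
  exact: cell_radius_bounds cm.
have bq c : c \in cells d m J -> b c \in 0 :: q.
  by move=> cm; have [bN _] := Pb c cm; exact: sq.
have F := path_family_loops (ltnW d2) loop pq aq bq.
exists (size q + \sum_(c <- cells d m J) len c)%N, (last 0 q), (flatten (map U (cells d m J))).
have sqb := leq_trans lq (cube_volume_bound J).
have sqr : (size q)%:R <= Cq * A ^+ (4 * d.-1).
  by rewrite /Cq /A -natrX -natrM ler_nat.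
have Ap k : 1 <= A ^+ k by rewrite exprn_ege1.
have cc0 : 0 <= (crust_const d)%:R :> R by [].
split.
- rewrite natrD; have H1 := cells_length d2 mJ.
  have {H1} H1 : (\sum_(c <- cells d m J) len c)%:R <= (2 * crust_const d)%:R * A ^+ (4 * d + 3).
    by rewrite /A -natrX -natrM ler_nat.
  have H2 : A ^+ (4 * d.-1) <= A ^+ (4 * d + 3).
    by rewrite ler_weXn2l // (leq_trans _ (leq_addr _ _)) // leq_mul2l leq_pred.
  have H3 : Cq * A ^+ (4 * d.-1) <= Cq * A ^+ (4 * d + 3).
    by rewrite ler_wpM2l // (le_trans ler01).
  apply: (@le_trans _ _ ((Cq + (2 * crust_const d)%:R) * A ^+ (4 * d + 3))).
    by rewrite mulrDl lerD // (le_trans sqr).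
  rewrite ler_wpM2r ?(le_trans ler01) // /C -addrA lerDl.
  have Cq0 : 0 <= Cq by exact: le_trans Cq1.
  by rewrite addr_ge0 // !mulr_ge0 // ltW.
- have := mem_last 0 q; rewrite inE => /orP[/eqP ->|/(allP aq) //].
  by rewrite /cube (_ : supn 0 = 0)%N // /supn big1 // => i _; rewrite mxE.
- apply: path_family_weaken F => //.
  have H := cells_cost d2 (ltW C10) mJ.
  have H2 := ler_wpM2r L00 sqr.
  have e : 0 <= A ^+ (4 * d.-1) by rewrite (le_trans ler01).
  apply: (@le_trans _ _ ((Cq * L0 + 2 * C1 * (crust_const d)%:R) * A ^+ (4 * d.-1))).
    by rewrite mulrDl lerD // mulrAC.
  by rewrite ler_wpM2r // /C -addrA lerDr addr_ge0 // (le_trans ler01).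
- move=> v Hv; have [c cm Hc] := cells_cover d2 Hv.
  apply/flattenP; exists (U c); first exact: map_f.
  apply: in_shift_core Hc.
  have /andP[H _] := cell_radius_bounds d2 cm; apply: leq_trans H.
  by rewrite leq_pmull.
Qed.

(** After the covering, [k] more steps are confined to the cube at cost [4 / A ^+ 8] each; an
    arbitrary starting point for them costs a logarithm, absorbed into the constant. *)
Lemma walk_strategy : exists (m : nat) (C : R), 0 < C /\
  forall J : nat, (m <= J)%N -> exists2 n : nat, n%:R <= C * (2 ^ J)%:R ^+ (4 * d + 3) &
  forall k : nat, exists Ps : seq (seq V), [/\ uniq Ps,
    forall p, p \in Ps -> [/\ size p = (n + k)%N, path (@Defs.adjacent d) 0 p,
      all (cube (16 ^ J)) p &
      forall v, (supn v + 4 * 16 ^ m <= 16 ^ J)%N -> v \in 0 :: take n p] &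
    expR (- (C * (2 ^ J)%:R ^+ (4 * d.-1) + 4 * k%:R / (2 ^ J)%:R ^+ 8))
      * (2 * d)%:R ^+ (n + k) <= (size Ps)%:R].
Proof.
have [m [C [C0 H]]] := cover_strategy.
exists m, (C + 8 * d%:R); split; first by rewrite ltr_wpDr ?mulr_ge0.
move=> J mJ; have [n [y [U [nC yN [Ps [uP HP cP]] HU]]]] := H J mJ; set A : R := (2 ^ J)%:R in nC cP *.
have A1 : 1 <= A by rewrite ler1n expn_gt0.
exists n; first by rewrite (le_trans nC) // ler_wpM2r ?exprn_ge0 ?(le_trans ler01) // lerDl mulr_ge0.
move=> k; set N := (16 ^ J)%N in HP yN HU *.
have N0 : (0 < N)%N by rewrite expn_gt0.
have A4 : A ^+ 4 = N%:R by rewrite /A /N -natrX -expnM mulnC (_ : 16 = 2 ^ 4)%N // -expnM mulnC.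
have [x Ex] : exists x : box d (2 * N), y = shift_box (corner 0 N) x.
  by apply: in_shift => i; rewrite mxE subr0; move/supn_leP: yN; apply.
have [||||Qs [uQ HQ cQ]] := @box_stay_family R d (cube N) (2 * N) (corner 0 N) x k (A ^+ 4 / 2).
- by move=> z; apply: supn_shift; rewrite [supn 0]big1 // => i _; rewrite mxE.
- rewrite A4; have -> : (2 * N).+2%:R = 2 * N%:R + 2 :> R by rewrite -natr1 -natr1 natrM; lra.
  by have : 0 <= N%:R :> R by []; lra.
- by rewrite divr_gt0 // A4 ltr0n.
- by rewrite ler_nat; lia.
rewrite -Ex in HQ.
exists [seq p ++ r | p <- Ps, r <- Qs]; split.
- apply: allpairs_uniq => // -[p r] [p' r'] /allpairsP[[a b] /= [aP bQ [-> ->]]].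
  move=> /allpairsP[[a' b'] /= [aP' bQ' [-> ->]]] /= /eqP.
  have [s1 _ _ _ _] := HP _ aP; have [s2 _ _ _ _] := HP _ aP'.
  by rewrite eqseq_cat ?s1 ?s2 // => /andP[/eqP -> /eqP ->].
- move=> _ /allpairsP[[p r] /= [pP rQ ->]].
  have [sp pp lp ap Up] := HP _ pP; have [sr pr ar] := HQ _ rQ.
  split; first by rewrite size_cat sp sr.
  + by rewrite cat_path pp lp pr.
  + by rewrite all_cat ap ar.
  + by move=> v Hv; rewrite take_cat sp ltnn subnn take0 cats0; apply/Up/HU.
rewrite size_allpairs [(size Ps * _)%:R]natrM.
apply: le_trans (ler_pM _ _ cP cQ); rewrite ?mulr_ge0 ?expR_ge0 ?exprn_ge0 //.
rewrite mulrACA -exprD ler_wpM2r ?exprn_ge0 // -expRD ler_expR -opprD lerN2.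
have -> : k%:R * (A ^+ 4 / 2) ^- 2 = 4 * k%:R / A ^+ 8.
  by field; rewrite gt_eqF // (lt_le_trans ltr01).
have ln8 : ln (2 * (2 * N).+2%:R) <= 8 * A ^+ (4 * d.-1) :> R.
  have p0 : 0 < 2 * (2 * N).+2%:R :> R by rewrite mulr_gt0.
  apply: le_trans (ltW (ln_sublinear p0)) _.
  apply: (@le_trans _ _ (8 * A ^+ 4)); first by rewrite A4 -!natrM ler_nat; lia.
  by rewrite ler_wpM2l // ler_weXn2l // -{1}[4%N]muln1 leq_mul2l /= -ltnS prednK // ltnW.
have dR : 0 <= d%:R :> R by [].
have := ler_wpM2l dR ln8; rewrite mulrDl; set X := A ^+ _; set Y := 4 * _ / _; lra.
Qed.
End CoverPaths.

(** * Holding times and the partition function *)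

Section MeasureLemmas.
Context (disp : measure_display) (T : measurableType disp) (R : realType).
Variable P : probability T R.
Local Open Scope ereal_scope.

(* Read off from the definition of the integral as a supremum over simple functions,
   because [boundary_size] is never shown to be measurable. *)
Lemma expectation_ge (f : T -> R) (A : set T) (c : R) : measurable A ->
    (0 <= c)%R -> (forall w, 0 <= f w)%R -> (forall w, A w -> c <= f w)%R ->
  c%:E * P A <= 'E_P[f].
Proof.
move=> mA c0 f0 cf; rewrite unlock.
have -> : c%:E * P A = \int[P]_w (c * \1_A w)%:E.
  under eq_integral do rewrite EFinM.
  rewrite ge0_integralZl_EFin //; last by apply/measurable_EFinP; exact: measurable_indic.
  by rewrite integral_indic // setIT.
rewrite !ge0_integralTE; last 2 first.
- by move=> w; rewrite lee_fin.
- by move=> w; rewrite lee_fin mulr_ge0 // indicE.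
apply: le_ereal_sup => _ [h hf <-]; exists h => // w.
apply: le_trans (hf w) _; rewrite lee_fin indicE.
by have [/set_mem/cf H|_] := boolP (w \in A); rewrite ?mulr1 ?mulr0.
Qed.

Lemma probability_setD_ge (A : set T) (I : Type) (s : seq I) (F : I -> set T) :
    measurable A -> (forall i, measurable (F i)) ->
  P A <= P (A `\` \big[setU/set0]_(i <- s) F i) + \sum_(i <- s) P (A `&` F i).
Proof.
move=> mA mF; elim: s => [|i s IH]; first by rewrite !big_nil setD0 adde0.
have mU : measurable (\big[setU/set0]_(i <- s) F i) by exact: bigsetU_measurable.
apply: le_trans IH _; rewrite !big_cons addeA leeD2r //.
set U := \big[setU/set0]_(j <- s) F j in mU *.
have -> : A `\` U = (A `\` (F i `|` U)) `|` ((A `\` U) `&` F i).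
  by apply/seteqP; split=> w /=; [have := pselect (F i w); tauto|tauto].
have m1 : measurable (A `\` (F i `|` U)) by apply: measurableD => //; exact: measurableU.
have m2 : measurable ((A `\` U) `&` F i) by apply: measurableI => //; exact: measurableD.
rewrite measureU //; last by apply/seteqP; split=> w //=; tauto.
rewrite leeD2l //; apply: le_measure; rewrite ?inE //; first exact: measurableI.
by move=> w [[]].
Qed.

Lemma probability_bigsetU_ge (I : choiceType) (s : seq I) (F : I -> set T) (c : \bar R) :
    uniq s -> (forall i, measurable (F i)) ->
    (forall i j w, i \in s -> j \in s -> F i w -> F j w -> i = j) ->
    (forall i, i \in s -> c <= P (F i)) ->
  \sum_(i <- s) c <= P (\big[setU/set0]_(i <- s) F i).
Proof.
move=> + mF; elim: s => [|i s IH]; first by rewrite !big_nil.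
move=> /= /andP[is_ us] dF cF; rewrite !big_cons measureU //; last 2 first.
- exact: bigsetU_measurable.
- apply/seteqP; split=> w //= -[Fi]; rewrite -bigcup_seq => -[j js Fj].
  by move: is_; rewrite (dF i j w) ?mem_head // ?inE; [move/negP; apply; exact: js|rewrite js orbT].
apply: leeD; first by apply: cF; exact: mem_head.
apply: IH => // [j k w js ks|j js]; last by apply: cF; rewrite inE js orbT.
by apply: dF; rewrite inE ?js ?ks orbT.
Qed.

End MeasureLemmas.

(** * Joint law of finitely many holding times and steps *)

Section WalkEvents.
Context (disp : measure_display) (T : measurableType disp) (R : realType).
Context (P : probability T R) (d : nat) (X : R -> T -> 'rV[int]_d).
Context (hold : nat -> {RV P >-> R}) (step : nat -> T -> 'rV[int]_d).
Hypothesis W : walk_construction X hold step.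
Local Notation V := 'rV[int]_d.

Definition step_event (s : nat -> V) (M : nat) : set T :=
  [set w | forall k, (k < M)%N -> step k w = s k].

Definition hold_event (Ks : seq nat) (D : set R) : set T :=
  [set w | forall k, k \in Ks -> D (hold k w)].

Lemma measurable_step_event s M : measurable (step_event s M).
Proof.
have -> : step_event s M = \bigcap_(k in [set k | (k < M)%N]) (step k @^-1` [set s k]).
  by apply/seteqP; split=> w H k; exact: H.
by apply: bigcap_measurableType => k _; exact: (step_measurable W).
Qed.

Lemma measurable_hold_preimage k (D : set R) : measurable D -> measurable (hold k @^-1` D).
Proof. by move=> mD; rewrite -[X in measurable X]setTI; exact: measurable_funP. Qed.

Lemma measurable_hold_event Ks D : measurable D -> measurable (hold_event Ks D).
Proof.
move=> mD; have -> : hold_event Ks D = \bigcap_(k in [set k | k \in Ks]) (hold k @^-1` D).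
  by apply/seteqP; split=> w H k; exact: H.
by apply: bigcap_measurableType => k _; exact: measurable_hold_preimage.
Qed.

Lemma probability_hold k (D : set R) : measurable D ->
  P (hold k @^-1` D) = exponential_prob (2 * d)%:R D.
Proof. by move=> mD; rewrite -(hold_law W k mD). Qed.

(** Independence over a finite index set that mixes holding times [inl k] and steps [inr k]. *)
Lemma probability_hold_step (Ks : seq nat) (D : set R) (s : nat -> V) (M : nat) :
    uniq Ks -> measurable D -> (forall k, (k < M)%N -> Defs.adjacent 0 (s k)) ->
  P (hold_event Ks D `&` step_event s M) =
  ((exponential_prob (2 * d)%:R D) ^+ size Ks * ((2 * d)%:R ^- M)%:E)%E.
Proof.
move=> uK mD adj.
pose S : seq (nat + nat) := map inl Ks ++ map inr (iota 0 M).
pose J : {fset nat + nat} := seq_fset tt S.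
pose E (i : nat + nat) : set T :=
  match i with inl k => hold k @^-1` D | inr k => step k @^-1` [set s k] end.
have memJ i : (i \in J) = (i \in S) by rewrite seq_fsetE.
have indep := hold_step_independent W.
have := indep J E.
have -> : \bigcap_(i in [set` J]) E i = hold_event Ks D `&` step_event s M.
  apply/seteqP; split=> [w H|w [H1 H2] [k|k]] /=.
  - split=> k kM.
      by have := H (inl k); rewrite /= memJ mem_cat map_f // => /(_ isT).
    have := H (inr k); rewrite /= memJ mem_cat map_f ?orbT; first exact.
    by rewrite mem_iota.
  - rewrite memJ mem_cat => /orP[/mapP[k' kK [->]]|/mapP[? _ //]].
    exact: H1.
  - rewrite memJ mem_cat => /orP[/mapP[? _ //]|/mapP[k' + [->]]].
    by rewrite mem_iota => /= kM; exact: H2.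
move=> ->; last first.
  move=> [k|k] _ /=.
    by exists D => //; rewrite setTI.
  by exists [set s k] => //; rewrite setTI.
have uS : uniq S.
  rewrite cat_uniq !map_inj_uniq ?uK ?iota_uniq ?andbT /=; last 2 first.
  - by move=> ? ? [].
  - by move=> ? ? [].
  by apply/hasPn => _ /mapP[k _ ->]; apply/mapP => -[].
rewrite (perm_big S); last first.
  by apply: uniq_perm => //; exact: fset_uniq.
rewrite big_cat !big_map /=; congr (_ * _)%E.
  rewrite (eq_bigr (fun=> exponential_prob (2 * d)%:R D)); last first.
    by move=> k _; exact: probability_hold.
  by elim: (Ks) => [|k K IH]; rewrite ?big_nil ?big_cons ?IH ?expe0 ?expeS.
rewrite big_seq (eq_bigr (fun=> ((2 * d)%:R^-1)%:E)); last first.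
  by move=> k; rewrite mem_iota => /= kM; apply: (step_law W); exact: adj.
rewrite -big_seq -exprVn; move: ((2 * d)%:R^-1) => c.
have H m j : (\prod_(i <- iota j m) c%:E = (c ^+ m)%:E)%E.
  by elim: m j => [|m IH] j; rewrite ?big_nil ?expr0 //= big_cons IH exprS EFinM.
exact: H.
Qed.

End WalkEvents.

(** * Control of the jump times *)

Section HoldBounds.
Context (disp : measure_display) (T : measurableType disp) (R : realType).
Context (P : probability T R) (d : nat) (X : R -> T -> 'rV[int]_d).
Context (hold : nat -> {RV P >-> R}) (step : nat -> T -> 'rV[int]_d).
Hypothesis W : walk_construction X hold step.
Local Notation V := 'rV[int]_d.
Local Notation expd := (@exponential_prob R (2 * d)%:R).

Lemma exponential_small (eps : R) : 0 < eps ->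
  (0 <= expd `[0%R, eps]%classic <= ((2 * d)%:R * eps)%:E)%E.
Proof.
move=> e0; rewrite exponential_prob_itv0c // -EFinB !lee_fin.
have := expR_ge1Dx (- (2 * d)%:R * eps).
have : expR (- (2 * d)%:R * eps) <= 1 by rewrite -expR0 ler_expR mulNr oppr_le0 mulr_ge0 // ltW.
by move=> *; apply/andP; split; lra.
Qed.

Lemma exponential_large (tau : R) : 0 < tau ->
  expd (~` `[0%R, tau]%classic) = (expR (- ((2 * d)%:R * tau)))%:E.
Proof.
move=> t0; have mI : measurable (`[0%R, tau]%classic : set R) by exact: measurable_itv.
rewrite -(probability_hold W 0 (measurableC mI)) preimage_setC.
rewrite probability_setC; last exact: (measurable_hold_preimage hold 0 mI).
rewrite (probability_hold W 0 mI) exponential_prob_itv0c //.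
by rewrite -!EFinB mulNr; congr EFin; ring.
Qed.

Lemma jump_timeS n w : jump_time hold n.+1 w = jump_time hold n w + hold n w.
Proof. by rewrite /jump_time big_nat_recr. Qed.

Lemma jump_time_mono n m w : (n <= m)%N -> jump_time hold n w <= jump_time hold m w.
Proof.
move=> /subnK <-; elim: (m - n)%N => [|k IH]; first by rewrite add0n.
by rewrite addSn jump_timeS (le_trans IH) // lerDl ltW // (hold_gt0 W).
Qed.

Lemma jump_time_le (m : nat) (tau : R) w :
  (forall k, (k < m)%N -> hold k w <= tau) -> jump_time hold m w <= m%:R * tau.
Proof.
elim: m => [|m IH] H; first by rewrite /jump_time big_nil mul0r.
rewrite jump_timeS -natr1 mulrDl mul1r lerD ?H // IH // => k km.
by apply: H; exact: leqW.
Qed.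

(** More than half of the [M] holding times exceed [eps]. *)
Lemma jump_time_gt (M : nat) (eps : R) w : 0 < eps ->
    (#|[pred k : 'I_M | (hold k w <= eps)%R]|.*2 < M)%N ->
  M%:R * (eps / 2) < jump_time hold M w.
Proof.
move=> e0 H; set A := #|_| in H; pose B := #|[pred k : 'I_M | ~~ (hold k w <= eps)]|.
have AB : (A + B = M)%N.
  by rewrite -[RHS]card_ord -(cardC [pred k : 'I_M | hold k w <= eps]); congr (_ + _)%N; apply: eq_card.
have : B%:R * eps <= jump_time hold M w.
  rewrite /jump_time big_mkord mulr_natl -sumr_const.
  rewrite [leRHS](bigID (fun k : 'I_M => hold k w <= eps)) /=.
  apply: ler_wpDl; first by apply: sumr_ge0 => k _; rewrite ltW // (hold_gt0 W).
  by apply: ler_sum => k; rewrite inE -ltNge => /ltW.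
apply: lt_le_trans; rewrite mulrA ltr_pdivrMr // mulrAC ltr_pM2r //.
by rewrite -natrM ltr_nat; lia.
Qed.

(* An entry [(Ks, D)] stands for the event that [hold k] lies in [D] for every [k] in
   [Ks]; on such rectangles independence of the holding times and the steps applies. *)
Definition bad_long (m : nat) (tau : R) : seq (seq nat * set R) :=
  [seq ([:: k], ~` `[0%R, tau]%classic) | k <- iota 0 m].

(** That at least half of the first [M] holding times are at most [eps] is written as a union over
    the index sets of at least that size; bounding their number by [2 ^ M] suffices. *)
Definition bad_short (M : nat) (eps : R) : seq (seq nat * set R) :=
  [seq ([seq val i | i <- enum J], `[0%R, eps]%classic)
     | J : {set 'I_M} <- enum {set 'I_M} & (M <= #|J|.*2)%N].

Definition good_hold (m M : nat) (tau eps : R) : set T :=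
  ~` \big[setU/set0]_(b <- bad_long m tau ++ bad_short M eps) hold_event hold b.1 b.2.

Lemma good_hold_jump_time m M tau eps w : 0 < eps -> good_hold m M tau eps w ->
  jump_time hold m w <= m%:R * tau /\ M%:R * (eps / 2) < jump_time hold M w.
Proof.
move=> e0; rewrite /good_hold -bigcup_seq => G.
have ng b : b \in bad_long m tau ++ bad_short M eps -> ~ hold_event hold b.1 b.2 w.
  by move=> bin H; apply: G; exists b.
split.
  apply: jump_time_le => k km; rewrite leNgt; apply/negP => tk.
  apply: (ng ([:: k], ~` `[0%R, tau]%classic)); first by rewrite mem_cat map_f // mem_iota.
  by move=> k'; rewrite inE => /eqP -> /=; rewrite in_itv /= => /andP[_]; rewrite leNgt tk.
apply: jump_time_gt => //; rewrite ltnNge; apply/negP => HM.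
pose J := finset [pred k : 'I_M | hold k w <= eps].
apply: (ng ([seq val i | i <- enum J], `[0%R, eps]%classic)).
  rewrite mem_cat; apply/orP; right; apply/mapP; exists J => //.
  by rewrite mem_filter mem_enum andbT cardsE.
move=> k /= /mapP[i +  ->]; rewrite mem_enum inE /= => Hi.
by rewrite in_itv /= Hi andbT ltW // (hold_gt0 W).
Qed.

(** Long holding times lose at most a quarter of the probability of the steps, by hypothesis. Short
    ones lose a fraction at most [2 ^ M * 16 ^ (- M / 2) = 2 ^ - M], again at most a quarter as
    [M >= 2]. *)
Lemma probability_good_step (s : nat -> V) (m M : nat) (tau : R) :
    (0 < d)%N -> (forall k, (k < M)%N -> Defs.adjacent 0 (s k)) -> 0 < tau -> (1 < M)%N ->
    m%:R * expR (- ((2 * d)%:R * tau)) <= 4^-1 ->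
  ((2^-1 * (2 * d)%:R ^- M)%:E <=
     P (step_event step s M `&` good_hold m M tau (32 * d%:R)^-1))%E.
Proof.
move=> d0 adj t0 M1 mt; set eps := (32 * d%:R)^-1.
have dR : 0 < d%:R :> R by rewrite ltr0n.
have e0 : 0 < eps by rewrite invr_gt0 mulr_gt0.
set q : R := (2 * d)%:R ^- M.
have q0 : 0 <= q by rewrite invr_ge0 exprn_ge0.
set bads := bad_long m tau ++ bad_short M eps.
have mF (b : seq nat * set R) : b \in bads -> measurable b.2.
  rewrite mem_cat => /orP[/mapP[k _ ->]|/mapP[J _ ->]] /=.
    by apply: measurableC; exact: measurable_itv.
  exact: measurable_itv.
pose F (b : seq nat * set R) := if b \in bads then hold_event hold b.1 b.2 else set0.
have mF' b : measurable (F b).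
  by rewrite /F; case: ifP => // /mF; exact: measurable_hold_event.
have UE : \big[setU/set0]_(b <- bads) hold_event hold b.1 b.2 = \big[setU/set0]_(b <- bads) F b.
  by rewrite big_seq [RHS]big_seq; apply: eq_bigr => b bb; rewrite /F bb.
have mS := measurable_step_event W s M.
have PS : P (step_event step s M) = q%:E.
  have := probability_hold_step W (Ks := [::]) (D := setT) isT measurableT adj.
  have -> : hold_event hold [::] setT = setT by apply/seteqP; split.
  by rewrite setTI /= mul1e.
have PF b : b \in bads -> P (step_event step s M `&` F b) =
    (expd b.2 ^+ size b.1 * q%:E)%E.
  move=> bb; rewrite /F bb setIC; apply: (probability_hold_step W) => //; last exact: mF.
  move: bb; rewrite mem_cat => /orP[/mapP[k _ ->] //|/mapP[J _ ->]] /=.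
  by rewrite map_inj_uniq ?enum_uniq //; exact: val_inj.
have Hlong : (\sum_(b <- bad_long m tau) P (step_event step s M `&` F b) <= (4^-1 * q)%:E)%E.
  rewrite big_seq (eq_bigr (fun=> (expR (- ((2 * d)%:R * tau)) * q)%:E)); last first.
    move=> b bb; rewrite PF ?mem_cat ?bb //; case/mapP: bb => k _ -> /=.
    by rewrite exponential_large.
  rewrite -big_seq sumEFin lee_fin big_map big_const_seq count_predT size_iota iter_addr_0.
  by rewrite -[leLHS]mulr_natl mulrA ler_wpM2r.
(* The choice of [eps] makes [2 * d * eps = 1 / 16]. *)
have [r [Er r0 r1]] : exists r : R, [/\ expd `[0%R, eps]%classic = r%:E, 0 <= r & r <= 4^-1 ^+ 2].
  have := exponential_small e0; rewrite exponential_prob_itv0c // -EFinB !lee_fin => /andP[H1 H2].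
  exists (1 - expR (- (2 * d)%:R * eps)); split=> //; apply: le_trans H2 _.
  rewrite le_eqVlt; apply/orP; left; apply/eqP; rewrite /eps natrM; field.
  by rewrite gt_eqF.
have Hshort : (\sum_(b <- bad_short M eps) P (step_event step s M `&` F b) <= (4^-1 * q)%:E)%E.
  apply: (@le_trans _ _ (\sum_(b <- bad_short M eps) (4^-1 ^+ M * q)%:E)%E).
    rewrite big_seq [leRHS]big_seq; apply: lee_sum => b bb.
    rewrite PF ?mem_cat ?bb ?orbT //; case/mapP: bb => J.
    rewrite mem_filter => /andP[MJ _] -> /=.
    rewrite size_map -cardE Er -EFin_expe -EFinM lee_fin ler_wpM2r //.
    apply: (@le_trans _ _ ((4^-1 ^+ 2) ^+ #|J|)); first by apply: lerXn2r; rewrite ?nnegrE ?exprn_ge0 ?invr_ge0.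
    by rewrite -exprM mul2n ler_wiXn2l ?invr_ge0 // invf_le1 // ler1n.
  rewrite sumEFin lee_fin big_const_seq count_predT iter_addr_0 -[leLHS]mulr_natl mulrA ler_wpM2r //.
  have sz : (size (bad_short M eps) <= 2 ^ M)%N.
    rewrite size_map size_filter (leq_trans (count_size _ _)) // -cardE.
    by rewrite -cardsT -powersetT card_powerset cardsT card_ord.
  apply: (@le_trans _ _ ((2 ^ M)%:R * 4^-1 ^+ M)); first by rewrite ler_wpM2r ?exprn_ge0 ?invr_ge0 // ler_nat.
  have -> : (2 ^ M)%:R * 4^-1 ^+ M = 2^-1 ^+ M :> R.
    by rewrite natrX -exprMn; congr (_ ^+ _); lra.
  have -> : 4^-1 = 2^-1 ^+ 2 :> R by lra.
  by rewrite ler_wiXn2l ?invr_ge0 // invf_le1 // ler1n.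
have := probability_setD_ge P bads mS mF'.
rewrite PS -UE setDE -/(good_hold m M tau eps) big_cat /= => H.
have {Hlong Hshort} := leeD Hlong Hshort; rewrite -EFinD => H2.
have := le_trans H (leeD (lexx _) H2).
have fin : P (step_event step s M `&` good_hold m M tau eps) \is a fin_num.
  apply: fin_num_measure; apply: measurableI => //; apply: measurableC.
  by rewrite UE; exact: bigsetU_measurable.
rewrite -(fineK fin) -EFinD !lee_fin; lra.
Qed.

End HoldBounds.

(** * From path families to the partition function *)

Section PartitionBound.
Context (disp : measure_display) (T : measurableType disp) (R : realType).
Context (P : probability T R) (d : nat) (X : R -> T -> 'rV[int]_d).
Context (hold : nat -> {RV P >-> R}) (step : nat -> T -> 'rV[int]_d).
Hypothesis W : walk_construction X hold step.
Local Notation V := 'rV[int]_d.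

Lemma jump_chain_range m t w n : jump_time hold m w <= t -> (n <= m)%N ->
  walk_range X t w (jump_chain step n w).
Proof.
move=> mt nm; exists (jump_time hold n w); split.
  rewrite (le_trans (jump_time_mono W w nm) mt) andbT.
  have := jump_time_mono W w (leq0n n).
  by apply: le_trans; rewrite /jump_time big_nil.
by apply: (walk_path W); rewrite lexx jump_timeS ltrDl (hold_gt0 W).
Qed.

Lemma range_jump_chain M t w v : t < jump_time hold M w -> walk_range X t w v ->
  exists2 n, (n < M)%N & v = jump_chain step n w.
Proof.
move=> tM [s [/andP[s0 st] <-]].
have ex : exists n, s < jump_time hold n w by exists M; exact: le_lt_trans tM.
(* The least index of a jump time beyond [s] is positive, and at time [s] the walk sits at the
   preceding state of the jump chain. *)
have := ex_minnP ex; case=> -[|n] Hn nmin.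
  by move: Hn; rewrite /jump_time big_nil ltNge s0.
exists n; first by apply: nmin; exact: le_lt_trans tM.
apply: (walk_path W); rewrite Hn andbT leNgt; apply/negP => /nmin.
by rewrite ltnn.
Qed.

Lemma supn_adjacent (x y : V) : Defs.adjacent x y -> (supn y <= (supn x).+1)%N.
Proof.
move=> /eqP xy; apply/supn_leP => i; have := le_supn x i.
have : `|x 0 i - y 0 i| <= 1 by rewrite -xy (bigD1 i) //= lerDl sumr_ge0.
lia.
Qed.

Lemma boundary_size_le t w (s : seq V) :
  inner_boundary (walk_range X t w) `<=` [set` s] -> (boundary_size X t w <= size s)%N.
Proof.
move=> sub; have fin : finite_set (inner_boundary (walk_range X t w)).
  by apply: sub_finite_set sub _; exact: finite_seq.
apply: uniq_leq_size; first exact: fset_uniq.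
move=> x xin; apply: sub; move: xin; rewrite in_fset_set // => xin.
exact: set_mem.
Qed.

(** A point deeper than [K] has all its neighbours at depth at least [K], hence visited, and is not
    a boundary point. *)
Lemma boundary_size_crust t w (N K : nat) :
    (forall v, walk_range X t w v -> cube N v) ->
    (forall v, (supn v + K <= N)%N -> walk_range X t w v) ->
  (boundary_size X t w <= size (crust d N K))%N.
Proof.
move=> HN HK; apply: boundary_size_le => x [Rx [y [xy ny]]] /=.
have := HN x Rx; rewrite /cube mem_crust => -> /=.
have := supn_adjacent xy; rewrite leqNgt => xy'.
by rewrite leqNgt; apply/negP => Hx; apply: ny; apply: HK; move: xy' Hx; lia.
Qed.

(** Paths are stored without their starting point [0], hence the shifted list. *)
Definition path_step (p : seq V) (k : nat) : V := nth 0 p k - nth 0 (0 :: p) k.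

Lemma path_step_adjacent (p : seq V) k : path (@Defs.adjacent d) 0 p ->
  (k < size p)%N -> Defs.adjacent 0 (path_step p k).
Proof.
move=> /(pathP 0) H kp; have := H k kp; rewrite /Defs.adjacent /path_step.
by congr (_ == _); apply: eq_bigr => i _; rewrite !mxE sub0r opprB.
Qed.

Lemma step_event_chain (p : seq V) w n : step_event step (path_step p) (size p) w ->
  (n <= size p)%N -> jump_chain step n w = nth 0 (0 :: p) n.
Proof.
move=> H; elim: n => [|n IH] np; first by rewrite /jump_chain big_nil.
rewrite /jump_chain big_nat_recr //= -/(jump_chain step n w) IH 1?ltnW // H //.
by rewrite /path_step addrC subrK.
Qed.

Lemma step_event_inj (p q : seq V) w : size p = size q ->
    step_event step (path_step p) (size p) w -> step_event step (path_step q) (size q) w ->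
  p = q.
Proof.
move=> spq Hp Hq; apply: (@eq_from_nth _ 0) => // i ip.
have E1 : jump_chain step i.+1 w = nth 0 p i := step_event_chain Hp ip.
by rewrite -E1 (step_event_chain Hq) // -spq.
Qed.

(** The events [G p] are disjoint, since the steps determine the path. On each, the covering part is
    complete by time [t] and fewer than [M] jumps have been made, so the range fills the cube up to
    the crust and does not leave it. *)
Lemma partition_function_ge (Ps : seq (seq V)) (N K m M : nat) (tau t beta : R) :
    (0 < d)%N -> uniq Ps -> (1 < M)%N -> (m <= M)%N -> 0 <= beta ->
    (forall p, p \in Ps -> [/\ size p = M, path (@Defs.adjacent d) 0 p,
      all (cube N) p & forall v, (supn v + K <= N)%N -> v \in 0 :: take m p]) ->
    0 < tau -> m%:R * tau <= t -> t <= M%:R * ((32 * d%:R)^-1 / 2) ->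
    m%:R * expR (- ((2 * d)%:R * tau)) <= 4^-1 ->
  ((expR (- (beta * (size (crust d N K))%:R)) *
     ((size Ps)%:R * (2^-1 * (2 * d)%:R ^- M)))%:E <= partition_function P X t beta)%E.
Proof.
move=> d0 uP M1 mM b0 HP t0 mt tM me; set eps : R := (32 * d%:R)^-1 in tM.
have e0 : 0 < eps by rewrite invr_gt0 mulr_gt0 // ltr0n.
pose G p := step_event step (path_step p) M `&` good_hold hold m M tau eps.
have mU : measurable (\big[setU/set0]_(b <- bad_long m tau ++ bad_short M eps)
    hold_event hold b.1 b.2).
  rewrite big_seq; apply: bigsetU_measurable => b; rewrite mem_cat.
  by move=> /orP[/mapP[k _ ->]|/mapP[J _ ->]] /=; apply: measurable_hold_event;
    [apply: measurableC; exact: measurable_itv|exact: measurable_itv].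
have mG p : measurable (G p).
  by apply: measurableI; [exact: measurable_step_event W _ _|exact: measurableC].
have PG p : p \in Ps -> ((2^-1 * (2 * d)%:R ^- M)%:E <= P (G p))%E.
  move=> /HP[sp pp _ _]; apply: (probability_good_step W) => // k kM.
  by apply: path_step_adjacent => //; rewrite sp.
have dG p q w : p \in Ps -> q \in Ps -> G p w -> G q w -> p = q.
  move=> /HP[sp _ _ _] /HP[sq _ _ _] [Hp _] [Hq _].
  by apply: (@step_event_inj p q w); rewrite ?sp ?sq.
have := probability_bigsetU_ge uP mG dG PG.
rewrite sumEFin big_const_seq count_predT iter_addr_0 -[X in X%:E]mulr_natl => HU.
apply: (@le_trans _ _ ((expR (- (beta * (size (crust d N K))%:R)))%:E *
    P (\big[setU/set0]_(p <- Ps) G p))%E).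
  by rewrite EFinM lee_pmul2l // ?lte_fin ?expR_gt0.
apply: expectation_ge.
- exact: bigsetU_measurable.
- exact: expR_ge0.
- by move=> w; exact: expR_ge0.
move=> w; rewrite -bigcup_seq => -[p /= pP [Hs Hg]].
have [sp _ ap cp] := HP p pP; rewrite -sp in Hs.
have [T1 T2] := good_hold_jump_time W e0 Hg.
rewrite ler_expR lerN2 ler_wpM2l // ler_nat; apply: boundary_size_crust => v.
  move=> /(range_jump_chain (le_lt_trans tM T2)) [n nM ->].
  rewrite (step_event_chain Hs) ?sp 1?ltnW //.
  case: n nM => [|n] nM /=; first by rewrite /cube (_ : supn 0 = 0)%N // /supn big1 // => i _; rewrite mxE.
  by apply: (allP ap); apply: mem_nth; rewrite sp ltnW.
move=> /cp /(nthP 0)[n nm <-].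
have nm' : (n <= m)%N by move: nm; rewrite /= size_take sp ltnS; case: ltnP => // H1 H2; lia.
have -> : nth 0 (0 :: take m p) n = jump_chain step n w.
  rewrite (step_event_chain Hs) ?sp ?(leq_trans nm') //.
  by case: n nm nm' => //= n _ nm'; rewrite nth_take.
by apply: jump_chain_range nm'; exact: le_trans T1 mt.
Qed.

(* When the walk does not move up to time [t], its range is a single point. *)
Lemma partition_function_still (t beta : R) : 0 < t -> 0 <= beta ->
  ((expR (- beta) * expR (- ((2 * d)%:R * t)))%:E <= partition_function P X t beta)%E.
Proof.
move=> t0 b0; pose D : set R := ~` `[0%R, t]%classic.
have mD : measurable D by apply: measurableC; exact: measurable_itv.
rewrite EFinM -(exponential_large W t0) -/D -(probability_hold W 0 mD).
apply: expectation_ge.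
- exact: measurable_hold_preimage.
- exact: expR_ge0.
- by move=> w; exact: expR_ge0.
move=> w Hw; rewrite ler_expR lerN2 ler_piMr //.
have ht : t < jump_time hold 1 w.
  rewrite jump_timeS /jump_time big_nil add0r ltNge; apply/negP => H; apply: Hw.
  by rewrite /= in_itv /= H andbT ltW // (hold_gt0 W).
have : (boundary_size X t w <= size [:: (0%R : V)])%N.
  apply: boundary_size_le => x [/(range_jump_chain ht)[n n1 ->] _] /=.
  by rewrite inE; case: n n1 => // _; rewrite /jump_chain big_nil.
by rewrite -(ler_nat R).
Qed.

End PartitionBound.

(** * Choice of the scale and conclusion *)

Section Scales.
Variable R : realType.

(** [J] is the integer logarithm of [t / beta] in base [16 ^ d.+1 = 2 ^ (4 * d.+1)]. *)
Lemma scale_exists (d : nat) (beta t : R) : 0 < beta -> beta <= t ->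
  exists J : nat, beta * (2 ^ J)%:R ^+ (4 * d.+1) <= t
                  < beta * 16 ^+ d.+1 * (2 ^ J)%:R ^+ (4 * d.+1).
Proof.
move=> b0 bt; pose q := Num.truncn (t / beta).
have q1 : (0 < q)%N by rewrite truncn_gt0 ler_pdivlMr // mul1r.
have tb0 : 0 <= t / beta by rewrite divr_ge0 ?(ltW b0) // (le_trans (ltW b0)).
have /andP[ql qr] := truncn_itv tb0.
have B1 : (1 < 16 ^ d.+1)%N by rewrite -{1}(expn0 16) ltn_exp2l.
have E j : (2 ^ j)%:R ^+ (4 * d.+1) = ((16 ^ d.+1) ^ j)%:R :> R.
  by rewrite -natrX (_ : 16 = 2 ^ 4)%N // -!expnM; congr (2 ^ _)%:R; ring.
have /andP[t1 t2] := trunc_log_bounds B1 q1.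
exists (trunc_log (16 ^ d.+1) q); rewrite E; apply/andP; split.
  rewrite mulrC -ler_pdivlMr //; apply: le_trans ql; by rewrite ler_nat.
rewrite -mulrA mulrC -ltr_pdivrMr //; apply: lt_le_trans qr _.
by rewrite -natrX -natrM ler_nat -expnS.
Qed.

(** Equality holds at [t = beta * A ^+ (4 * d.+1)], as [4 * (d + 1) * (1 - 2 / (d + 1)) = 4 * (d -
    1)], and the right side increases with [t]. *)
Lemma cost_exponent_ge (d : nat) (A beta t : R) : (1 < d)%N -> 0 < A -> 0 < beta ->
    beta * A ^+ (4 * d.+1) <= t ->
  beta * A ^+ (4 * d.-1) <= t `^ (1 - 2 / d.+1%:R) * beta `^ (2 / d.+1%:R).
Proof.
move=> d2 A0 b0 H; set p : R := 2 / d.+1%:R.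
have p0 : 0 <= 1 - p by rewrite subr_ge0 ler_pdivrMr // mul1r ler_nat ltnW.
have bA0 : 0 <= beta * A ^+ (4 * d.+1) by rewrite mulr_ge0 ?exprn_ge0 // ltW.
have H1 : (beta * A ^+ (4 * d.+1)) `^ (1 - p) <= t `^ (1 - p).
  by apply: ge0_ler_powR; rewrite ?nnegrE // (le_trans bA0).
apply: le_trans (ler_wpM2r (powR_ge0 _ _) H1).
rewrite powRM ?(ltW b0) ?exprn_ge0 ?(ltW A0) // mulrAC -powRD; last by apply/implyP => _; rewrite gt_eqF.
rewrite subrK powRr1 ?(ltW b0) // -!powR_mulrn ?(ltW A0) // -powRrM.
rewrite le_eqVlt; apply/orP; left; apply/eqP; congr (_ * _ `^ _).
rewrite /p; case: d d2 {p p0 bA0 H H1} => // d _ /=.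
rewrite !natrM -!natr1; field.
by rewrite natr1 natr1 pnatr_eq0.
Qed.
End Scales.

(** The range always has a boundary point, so the partition function is at most [expR (- beta)],
    while the exponent is [gamma * beta * (t / beta) ^ (1 - 2 / (d + 1))]. No fixed [gamma] can
    serve when [t / beta] tends to zero, hence the condition [beta <= t]. *)
Theorem proposition3p1 (R : realType) (d : nat) (hd : (2 <= d)%N)
    (beta0 : R) (hbeta0 : 0 < beta0) :
  exists gamma : R, 0 < gamma /\
    forall (disp : measure_display) (T : measurableType disp)
      (P : probability T R) (X : R -> T -> 'rV[int]_d),
      simple_random_walk P X ->
      forall beta t : R, beta0 < beta -> beta <= t ->
        ((expR (- (gamma * t `^ (1 - 2 / d.+1%:R) * beta `^ (2 / d.+1%:R))))%:E
           <= partition_function P X t beta)%E.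
Proof.
have d0 : (0 < d)%N := ltnW hd.
have [E1 E2] : (4 * d.+1 = (4 * d + 3).+1)%N /\ (4 * d.-1 + 8 = 4 * d.+1)%N by lia.
have [m [C [C0 strategy]]] := walk_strategy R hd.
pose K := (4 * 16 ^ m)%N.
pose D : R := (d * (2 * K.+1) * 3 ^ d.-1)%:R.
have D0 : 0 <= D by [].
have d0R : 0 < (2 * d)%:R :> R by rewrite ltr0n muln_gt0.
(* [c * A] will bound [2 * d * tau] from below, so that [Ha0] makes a holding time above [tau]
   unlikely among all [n] covering steps. *)
pose c : R := (2 * d)%:R * (beta0 / (C + 1)).
have c0 : 0 < c by rewrite mulr_gt0 // divr_gt0 // addr_gt0.
have [a0 Ha0] := poly_le_expR (4 * C) (4 * d + 3) c0.
(* Below scale [J0] one has [t <= beta * H], and it is enough that the walk stays at its starting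
   point. *)
pose J0 := maxn m a0.
pose H : R := 16 ^+ d.+1 * (2 ^ J0)%:R ^+ (4 * d.+1).
have H0 : 0 <= H by rewrite mulr_ge0 ?exprn_ge0.
(* [D] pays for the crust, [C / beta0] for the covering, the last term for confinement; [9] is [8]
   from rounding [k] plus [1] from a factor one half. [g2] serves the small scales: one boundary
   point and no jump. *)
pose g1 : R := D + (C + 9) / beta0 + 256 * d%:R * 16 ^+ d.+1.
pose g2 : R := 1 + (2 * d)%:R * H.
have g10 : 0 <= g1.
  apply: addr_ge0; last by rewrite mulr_ge0 ?exprn_ge0.
  by apply: addr_ge0 => //; rewrite divr_ge0 ?(ltW hbeta0) // addr_ge0 ?(ltW C0).
have g20 : 0 < g2 by rewrite ltr_pwDl // mulr_ge0.
exists (g1 + g2); split; first by rewrite ltr_wpDl.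
move=> disp T P X [hold [step W]] beta t b0b bt.
have b0 : 0 < beta := lt_trans hbeta0 b0b.
have t0 : 0 < t := lt_le_trans b0 bt.
have [J /andP[tl tu]] := scale_exists d b0 bt.
set A : R := (2 ^ J)%:R in tl tu.
have A1 : 1 <= A by rewrite ler1n expn_gt0.
have A0 : 0 < A := lt_le_trans ltr01 A1.
pose Q := beta * A ^+ (4 * d.-1).
have Ae : 1 <= A ^+ (4 * d.-1) by rewrite exprn_ege1.
have Qb : beta <= Q by rewrite ler_peMr // ltW.
have Q0 : 0 < Q := lt_le_trans b0 Qb.
have QE := cost_exponent_ge hd A0 b0 tl.
rewrite -/Q in QE.
suff : ((expR (- ((g1 + g2) * Q)))%:E <= partition_function P X t beta)%E.
  apply: le_trans; rewrite lee_fin ler_expR lerN2 -mulrA ler_wpM2l //.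
  by rewrite addr_ge0 // ltW.
have [JJ|JJ] := ltnP J J0.
  apply: le_trans (partition_function_still W t0 (ltW b0)).
  rewrite lee_fin -expRD ler_expR -opprD lerN2.
  have tH : t <= beta * H.
    apply: le_trans (ltW tu) _; rewrite -mulrA ler_wpM2l ?(ltW b0) // ler_wpM2l ?exprn_ge0 //.
    by apply: lerXn2r; rewrite ?nnegrE // ler_nat leq_exp2l // ltnW.
  have H1 : (2 * d)%:R * t <= (2 * d)%:R * (beta * H) by rewrite ler_wpM2l // ltW.
  have H2 : beta * g2 <= Q * g2 by rewrite ler_wpM2r // ltW.
  have H3 : 0 <= g1 * Q by rewrite mulr_ge0 // ltW.
  rewrite /g2 in H2 *; lra.
move: JJ; rewrite geq_max => /andP[mJ aJ].
have [n nC fam] := strategy J mJ; rewrite -/A in nC fam.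
(* [M = n + k] exceeds [64 * d * t], so that [M * eps / 2 >= t] for [eps = 1 / (32 * d)]; the [.+2]
   also gives [M > 1]. *)
pose k := (Num.truncn (64 * d%:R * t)).+2.
have [Ps [uP HP cP]] := fam k.
have dR : 0 < d%:R :> R by rewrite ltr0n.
have x0 : 0 <= 64 * d%:R * t by rewrite !mulr_ge0 // ltW.
have /andP[kl kr] := truncn_itv x0.
(* The time is shared equally by the covering steps; [n.+1] avoids a division by zero. *)
pose tau := t / n.+1%:R.
have tau0 : 0 < tau by rewrite divr_gt0.
have tau_ge : beta0 / (C + 1) * A <= tau.
  rewrite /tau ler_pdivlMr //.
  have B1 : n.+1%:R <= (C + 1) * A ^+ (4 * d + 3).
    by rewrite -natr1 mulrDl mul1r lerD // exprn_ege1.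
  have B2 : beta0 * A ^+ (4 * d.+1) <= t.
    by apply: le_trans tl; rewrite ler_wpM2r ?exprn_ge0 // ltW.
  apply: le_trans B2.
  have -> : beta0 * A ^+ (4 * d.+1) = beta0 / (C + 1) * A * ((C + 1) * A ^+ (4 * d + 3)).
    have C1 : C + 1 != 0 by rewrite gt_eqF // addr_gt0.
    by rewrite E1 exprS -{1}(divfK C1 beta0); move: (beta0 / _) (A ^+ (4 * d + 3)) => u v; ring.
  by rewrite ler_wpM2l // mulr_ge0 // divr_ge0 // ?(ltW hbeta0) // addr_ge0 // ltW.
have me : n%:R * expR (- ((2 * d)%:R * tau)) <= 4^-1.
  have H1 : expR (- ((2 * d)%:R * tau)) <= expR (- (c * A)).
    by rewrite ler_expR lerN2 /c -mulrA ler_wpM2l // ltW.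
  have H2 : 4 * C * A ^+ (4 * d + 3) <= expR (c * A).
    by apply: Ha0; apply: leq_trans aJ _; apply: ltnW; exact: ltn_expl.
  apply: (@le_trans _ _ (C * A ^+ (4 * d + 3) * expR (- (c * A)))).
    by apply: ler_pM; rewrite ?expR_ge0.
  by rewrite expRN ler_pdivrMr ?expR_gt0 //; lra.
have := @partition_function_ge _ _ _ _ _ _ _ _ W Ps (16 ^ J) K n (n + k) tau t beta
  d0 uP _ (leq_addr _ _) (ltW b0).
have M1 : (1 < n + k)%N by rewrite /k !addnS.
have tM : t <= (n + k)%:R * ((32 * d%:R)^-1 / 2).
  rewrite -invfM ler_pdivlMr ?mulr_gt0 //.
  have : (Num.truncn (64 * d%:R * t)).+1%:R <= (n + k)%:R :> R by rewrite ler_nat /k !addnS ltnS leqW // leq_addl.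
  lra.
have mt : n%:R * tau <= t.
  by rewrite /tau mulrCA ler_piMr ?(ltW t0) // ler_pdivrMr // mul1r ler_nat.
move=> /(_ M1 HP tau0 mt tM me); apply: le_trans; rewrite lee_fin.
set N := (16 ^ J)%N.
have crustb : (size (crust d N K))%:R <= D * A ^+ (4 * d.-1).
  rewrite /D /A -natrX -natrM ler_nat; apply: leq_trans (size_crust _ _ d0) _.
  rewrite -[leqRHS]mulnA leq_mul2l; apply/orP; right.
  have -> : ((2 ^ J) ^ (4 * d.-1) = N ^ d.-1)%N.
    by rewrite /N (_ : 16 = 2 ^ 4)%N // -!expnM; congr expn; rewrite mulnCA.
  have N0 : (0 < N)%N by rewrite expn_gt0.
  by rewrite -expnMn leq_exp2r; [rewrite mulSn -add1n leq_add2r|rewrite -ltnS prednK].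
(* The lost factor one half is paid by one unit in the exponent. *)
have half : expR (- 1) <= 2^-1 :> R.
  by rewrite expRN lef_pV2 ?posrE ?expR_gt0 //; have := expR_ge1Dx (1 : R); lra.
have q0 : 0 < (2 * d)%:R ^+ (n + k) :> R by rewrite exprn_gt0.
have cP' : expR (- (C * A ^+ (4 * d.-1) + 4 * k%:R / A ^+ 8)) * 2^-1 <=
    (size Ps)%:R * (2^-1 * (2 * d)%:R ^- (n + k)).
  by rewrite mulrCA mulrC ler_pM2l ?invr_gt0 // ler_pdivlMr.
apply: (@le_trans _ _ (expR (- (beta * (size (crust d N K))%:R)) *
   (expR (- (C * A ^+ (4 * d.-1) + 4 * k%:R / A ^+ 8)) * expR (- 1)))); last first.
  rewrite ler_wpM2l ?expR_ge0 //; apply: le_trans cP'.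
  by rewrite ler_wpM2l ?expR_ge0.
rewrite -!expRD ler_expR -!opprD lerN2.
have T1 : beta * (size (crust d N K))%:R <= D * Q.
  by rewrite /Q mulrCA ler_wpM2l // ltW.
(* Costs without a factor [beta] are compared with [Q] through [beta0 < beta]. *)
have Qe : A ^+ (4 * d.-1) <= Q / beta0.
  by rewrite ler_pdivlMr // mulrC /Q ler_wpM2r ?exprn_ge0 // ltW.
(* Confinement lasts about [64 * d * t] steps, and [t / A ^+ 8] is at most of order [Q] by the
   maximality of [J]. *)
have T2 : 4 * k%:R / A ^+ 8 <= 256 * d%:R * 16 ^+ d.+1 * Q + 8.
  have A8 : 0 < A ^+ 8 by rewrite exprn_gt0.
  have A81 : 1 <= A ^+ 8 by rewrite exprn_ege1.
  rewrite ler_pdivrMr //.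
  have kb : k%:R <= 64 * d%:R * t + 2 by rewrite /k -addn2 natrD lerD2r.
  have E : A ^+ (4 * d.-1) * A ^+ 8 = A ^+ (4 * d.+1).
    by rewrite -exprD E2.
  have tb : t <= 16 ^+ d.+1 * Q * A ^+ 8.
    apply: le_trans (ltW tu) _; rewrite -E /Q le_eqVlt; apply/orP; left; apply/eqP; ring.
  have := ler_wpM2l (ltW dR) tb; lra.
have T3 : C * A ^+ (4 * d.-1) <= C * (Q / beta0) by rewrite ler_wpM2l // ltW.
have T4 : 9 <= 9 * (Q / beta0) by have := le_trans Ae Qe; lra.
have T5 : 0 <= g2 * Q by rewrite mulr_ge0 // ltW.
have -> : (g1 + g2) * Q = D * Q + (C * (Q / beta0) + 9 * (Q / beta0))
    + 256 * d%:R * 16 ^+ d.+1 * Q + g2 * Q.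
  by rewrite /g1; field; rewrite gt_eqF.
lra.
Qed.
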